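(* Let $\mu=\mu_1\otimes\dots\otimes\mu_d$ be a product probability measure on $\mathbb{R}^d$. For each $1\le k\le d$ let $a_k:\mathbb{R}\to(0,\infty)$ be a positive function and let $A_k$ be its primitive centered with respect to $\mu_k$ (i.e. $A_k'=a_k$ and $\int A_k\,d\mu_k=0$), with $A_k\in L^2(\mu_k)$. Let $f,g:\mathbb{R}^d\to\mathbb{R}$ be functions in $L^2(\mu)$ all of whose first and second partial derivatives are integrable with respect to $\mu$. (1) Let $f=e^{-\phi}$ and suppose that for all $x\in\mathbb{R}^d$, $$\partial_i\left(\frac{\partial_i\phi(x)}{a_i(x_i)}\right)\le 0\ \text{ and }\ \partial_i\left(\frac{\partial_i g(x)}{a_i(x_i)}\right)\ge 0\quad\text{for all }1\le i\le d,$$ and $$\partial_{i,j}\phi(x)\le 0\ \text{ and }\ \partial_{i,j}g(x)\ge 0\quad\text{for all }1\le i\ne j\le d.$$ Assume moreover that $f$ is orthogonal to the functions $A_i(x_i)$ for all $1\le i\le d$, i.e. $\mathrm{Cov}_\mu(f(x),A_i(x_i))=0$. Then $$\mathrm{Cov}_\mu(f,g)\ge 0.$$ (2) Let $f=e^{-\phi}$ and $g=e^{-\psi}$ and suppose that for all $x\in\mathbb{R}^d$, $$\partial_i\left(\frac{\partial_i\phi(x)}{a_i(x_i)}\right)\le 0\ \text{ and }\ \partial_i\left(\frac{\partial_i\psi(x)}{a_i(x_i)}\right)\le 0\quad\text{for all }1\le i\le d,$$ and $$\partial_{i,j}\phi(x)\le 0\ \text{ and }\ \partial_{i,j}\psi(x)\le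 0\quad\text{for all }1\le i\ne j\le d.$$ Assume moreover that the product measure $\mu$ is symmetric, that the functions $a_i$ are even for $1\le i\le d$, and that both $f$ and $g$ are even. Then $$\mathrm{Cov}_\mu(f,g)\ge 0.$$
   Context: $\mathrm{Cov}_\mu(f,g)=\int (f-\int f\,d\mu)(g-\int g\,d\mu)\,d\mu$. A measure $\mu$ on $\mathbb{R}^d$ is symmetric if it is invariant under $x\mapsto -x$ (for a product measure: each marginal is even); a function $f$ on $\mathbb{R}^d$ is even if $f(-x)=f(x)$. Standing convention: all functions have enough integrability and regularity for all written quantities to be well defined. *)

(* Defs.v *)
From HB Require Import structures.
From mathcomp Require Import all_boot all_order all_algebra.
From mathcomp Require Import all_classical all_reals all_analysis.
Import Order.TTheory GRing.Theory Num.Theory.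
Import numFieldNormedType.Exports.

Set Implicit Arguments.
Unset Strict Implicit.
Unset Printing Implicit Defensive.

Local Open Scope classical_set_scope.
Local Open Scope ring_scope.

(* The product sigma-algebra on R^n, i.e. the one generated by the coordinate
   maps (it is also the Borel sigma-algebra of R^n). This is the analogue for
   row vectors of the library's measurable structure on n.-tuple T. *)
Definition measure_rV_display : measure_display.
Proof. exact. Qed.

Section measurable_rV.
Context (R : realType) (n : nat).

Let coors : 'I_n -> 'rV[R]_n -> measurableTypeR R := fun i x => x ord0 i.

Let rV_set0 : g_sigma_preimage coors set0.
Proof. exact: sigma_algebra0. Qed.

Let rV_setC A : g_sigma_preimage coors A -> g_sigma_preimage coors (~` A).
Proof. exact: sigma_algebraC. Qed.

Let rV_bigcup (F : (set 'rV[R]_n)^nat) :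
  (forall i, g_sigma_preimage coors (F i)) ->
  g_sigma_preimage coors (\bigcup_i (F i)).
Proof. exact: sigma_algebra_bigcup. Qed.

HB.instance Definition _ := @isMeasurable.Build measure_rV_display
  'rV[R]_n (g_sigma_preimage coors) rV_set0 rV_setC rV_bigcup.

End measurable_rV.

Section defs.
Context (R : realType) (d : nat).
Implicit Types (mu : probability 'rV[R]_d R) (h : 'rV[R]_d -> R).

(* The value on measurable boxes determines mu, by the pi-lambda theorem. *)
Definition is_product_measure
    (muk : 'I_d -> probability (measurableTypeR R) R) mu :=
  forall B : 'I_d -> set (measurableTypeR R),
    (forall k, measurable (B k)) ->
    mu [set x | forall k, B k (x ord0 k)] = (\prod_(k < d) muk k (B k))%E.

Definition symmetric_measure mu :=
  forall B : set 'rV[R]_d, measurable B -> mu (-%R @^-1` B) = mu B.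

Definition even_fun (V : zmodType) (h : V -> R) := forall x, h (- x) = h x.

Definition unit_vec (i : 'I_d) : 'rV[R]_d := delta_mx ord0 i.

Definition pderiv (i : 'I_d) h : 'rV[R]_d -> R := fun x => 'D_(unit_vec i) h x.

Definition weighted_pderiv (a : 'I_d -> R -> R) (i : 'I_d) h : 'rV[R]_d -> R :=
  fun x => pderiv i h x / a i (x ord0 i).

(* The derivability clauses are needed because 'D_v h x is a total operator. *)
Definition integrable_pderivs mu h :=
  forall i : 'I_d, (forall x, derivable h x (unit_vec i)) /\
    mu.-integrable setT (EFin \o pderiv i h).

Definition integrable_pderivs2 mu h :=
  integrable_pderivs mu h /\
  forall i : 'I_d, integrable_pderivs mu (pderiv i h).

End defs.

(* Main.v *)
Require Import Defs.
From HB Require Import structures.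
From mathcomp Require Import all_boot all_order all_algebra.
From mathcomp Require Import perm.
From mathcomp Require Import all_classical all_reals all_analysis.
From mathcomp Require Import measurable_realfun.
From mathcomp Require Import ring lra.
Import Order.TTheory GRing.Theory Num.Theory.
Import numFieldNormedType.Exports.
Set Implicit Arguments.
Unset Strict Implicit.
Unset Printing Implicit Defensive.
Local Open Scope classical_set_scope.
Local Open Scope ring_scope.

(** The covariance is telescoped one coordinate at a time, and each step is
    bounded below by a moment whose sign is given by the FKG inequality.

    Let X and Y be independent with law mu, and let Z_m have the coordinates
    of Y below m and those of X from m on.  The mean of f(X) g(Z_m) goes from
    the mean of f g (m = 0) to the product of the means of f and g (m = d), so
    the covariance is the sum of the drops of this mean.  The drop at
    coordinate k is an average of covariances, under the k-th marginal, of a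
    slice of f and a slice of g.  The conditions on the weighted derivatives
    make these slices convex functions of A_k ([convex_wrt]), since the
    exponential of a convex function is convex.  For two convex functions of
    A_k, what is left after projecting out 1 and A_k is nonnegatively
    correlated ([covariance_convex_wrt]).  Therefore the drop is at least
    V_k^-1 times the moment E f(X) A_k(X_k) g(Z_(k+1)) A_k(Y_k), where V_k is
    the second moment of A_k ([interpolated_mean_step]), and it remains to see
    that this moment is nonnegative.

    The conditions on the mixed derivatives make f log-supermodular, and so
    allow f as a density in the FKG inequality ([fkg]), which follows from the
    four functions theorem of Ahlswede and Daykin ([four_functions]).

    - If f and g are even, the density is f(X) g(Z_(k+1)) and the increasing
      functions are A_k(X_k) and A_k(Y_k), whose weighted means vanish by
      symmetry ([cross_moment_ge0_even]).
    - If f is orthogonal to A_k, the density is f(X), and A_k(X_k) has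
      weighted mean zero.  Once Y_k is symmetrized against an independent copy
      T_k and Y, T_k are fixed, the remaining factor is increasing in X because
      g is supermodular ([cross_moment_ge0_orthogonal]).

    Only square integrability is available, so f(X) A_k(X_k) is integrable but
    need not be square integrable.  Products of four factors are therefore
    always regrouped as f(X) A_k(Y_k) times g(Z_(k+1)) A_k(X_k), where each
    A_k is independent of the function next to it ([sq_integrable_mul_free]).
    *)

(** * Means and square integrability *)

Section means.
Context d (T : measurableType d) (R : realType).
Implicit Types (m : {measure set T -> \bar R}) (f g : T -> R).

(** Integrability and the value of the integral travel together, so that the
    mean of an explicit linear combination is read off from the means of its
    terms, with one [ring] identity on each side. *)
Definition has_mean m f (v : R) :=
  m.-integrable setT (EFin \o f) /\ \int[m]_x f x = v.

Lemma has_mean_int m f : m.-integrable setT (EFin \o f) ->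
  has_mean m f (\int[m]_x f x).
Proof. by []. Qed.

Lemma has_meanD m f g u v : has_mean m f u -> has_mean m g v ->
  has_mean m (fun x => f x + g x) (u + v).
Proof.
move=> [fi fu] [gi gv]; split; last by rewrite RintegralD// fu gv.
by apply: (eq_integrable measurableT _ _ _ (integrableD measurableT fi gi)).
Qed.

Lemma has_meanZ m (c : R) f u : has_mean m f u ->
  has_mean m (fun x => c * f x) (c * u).
Proof.
move=> [fi fu]; split; last by rewrite RintegralZl// fu.
by apply: (eq_integrable measurableT _ _ _ (integrableZl measurableT c fi)).
Qed.

Lemma has_meanB m f g u v : has_mean m f u -> has_mean m g v ->
  has_mean m (fun x => f x - g x) (u - v).
Proof.
move=> [fi fu] [gi gv]; split; last by rewrite RintegralB// fu gv.
by apply: (eq_integrable measurableT _ _ _ (integrableB measurableT fi gi)).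
Qed.

Lemma has_mean_cst (P : probability T R) (c : R) : has_mean P (fun=> c) c.
Proof.
split; last by rewrite Rintegral_cst// [X in fine X](probability_setT P) mulr1.
exact: finite_measure_integrable_cst.
Qed.

Lemma eq_has_mean m f g u v : f =1 g -> u = v -> has_mean m f u ->
  has_mean m g v.
Proof. by move=> /funext-> <-. Qed.

Lemma has_mean_uniq m f u v : has_mean m f u -> has_mean m f v -> u = v.
Proof. by move=> [_ <-] [_ <-]. Qed.

Lemma has_mean_measurable m f u : has_mean m f u -> measurable_fun setT f.
Proof. by move=> [/integrableP[/measurable_EFinP]]. Qed.

Lemma has_mean_ge0 m f u : (\forall x \ae m, 0 <= f x) -> has_mean m f u ->
  0 <= u.
Proof.
move=> f0 [fi <-]; have mf := has_mean_measurable (has_mean_int fi).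
rewrite (_ : Rintegral _ _ _ = \int[m]_x `|f x|); first exact: Rintegral_ge0.
congr fine; apply: ae_eq_integral => //.
- exact/measurable_EFinP.
- by apply/measurable_EFinP; exact: measurableT_comp.
- by apply: filterS f0 => x f0 _ /=; rewrite ger0_norm.
Qed.

Lemma le_has_mean m f g u v : (\forall x \ae m, f x <= g x) ->
  has_mean m f u -> has_mean m g v -> u <= v.
Proof.
move=> fg fu gv; rewrite -subr_ge0; apply: (has_mean_ge0 _ (has_meanB gv fu)).
by apply: filterS fg => x; rewrite subr_ge0.
Qed.

Lemma ae_eq_integrable m (f g : T -> \bar R) : measurable_fun setT g ->
  ae_eq m setT f g -> m.-integrable setT f -> m.-integrable setT g.
Proof.
move=> mg fg /integrableP[mf fi]; apply/integrableP; split=> //.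
rewrite -(ge0_ae_eq_integral (f := fun x => `|f x|%E))//;
  [exact: measurableT_comp..|].
by apply: filterS fg => x h /h ->.
Qed.

Lemma ae_eq_has_mean m f g u : measurable_fun setT g ->
  (\forall x \ae m, f x = g x) -> has_mean m f u -> has_mean m g u.
Proof.
move=> mg fg [fi fu].
have mf := has_mean_measurable (has_mean_int fi).
have fg' : ae_eq m setT (EFin \o f) (EFin \o g).
  by apply: filterS fg => x /= ->.
split; last first.
  rewrite -fu; congr fine; apply/esym; apply: ae_eq_integral => //;
  exact/measurable_EFinP.
by apply: ae_eq_integrable fi => //; exact/measurable_EFinP.
Qed.

Lemma has_mean_eq0 m f : (forall x, 0 <= f x) -> has_mean m f 0 ->
  \forall x \ae m, f x = 0.
Proof.
move=> f0 [fi fu]; have mf := has_mean_measurable (has_mean_int fi).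
have h : (\int[m]_x `|(f x)%:E| = 0)%E.
  under eq_integral do rewrite abse_EFin ger0_norm//.
  by rewrite -[LHS]fineK ?integrable_fin_num//; congr EFin.
have [+ _] := ae_eq_integral_abs m measurableT
  (iffRL (measurable_EFinP _ f) mf).
by move=> /(_ h); apply: filterS => x /= /(_ I) [].
Qed.

Definition sq_integrable m f :=
  measurable_fun setT f /\ m.-integrable setT (EFin \o (fun x => f x ^+ 2)).

Lemma sq_integrableM m f g : sq_integrable m f -> sq_integrable m g ->
  m.-integrable setT (EFin \o (fun x => f x * g x)).
Proof.
move=> [mf fi] [mg gi].
have fgi := (has_meanD (has_mean_int fi) (has_mean_int gi)).1.
apply: (le_integrable measurableT _ _ fgi).
  by apply/measurable_EFinP; exact: measurable_funM.
move=> x _ /=; rewrite lee_fin normrM [leRHS]ger0_norm; last first.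
  by rewrite addr_ge0 ?sqr_ge0.
rewrite -(real_normK (num_real (f x))) -(real_normK (num_real (g x))).
by have := sqr_ge0 (`|f x| - `|g x|); have := sqr_ge0 (`|f x| + `|g x|); lra.
Qed.

Lemma sq_integrable_cst (P : probability T R) c : sq_integrable P (fun=> c).
Proof. by split=> //; exact: (has_mean_cst P (c ^+ 2)).1. Qed.

Lemma sq_integrable_int (P : probability T R) f : sq_integrable P f ->
  P.-integrable setT (EFin \o f).
Proof.
move=> fi; have := sq_integrableM fi (sq_integrable_cst P 1).
by apply: eq_integrable => // x _ /=; rewrite mulr1.
Qed.

Lemma Lfun_sq_integrable m f : f \in Lfun m 2%:E -> sq_integrable m f.
Proof.
move=> f2; split; last exact: Lfun2_integrable_sqr.
by move: f2; rewrite inE => /andP[]; rewrite inE.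
Qed.

End means.

(** * Measure-preserving maps and Fubini *)

Section measure_preserving.
Context d1 d2 (T1 : measurableType d1) (T2 : measurableType d2) (R : realType).
Variables (m1 : {measure set T1 -> \bar R}) (m2 : {measure set T2 -> \bar R}).

Definition preserving (phi : T1 -> T2) := measurable_fun setT phi /\
  forall A, measurable A -> m1 (phi @^-1` A) = m2 A.

Variables (phi : T1 -> T2).
Hypothesis phiP : preserving phi.

Let push : {measure set T2 -> \bar R} := @Measure.clone _ _ _ _
  (measure_function_pushforward__canonical__measure_function_Measure m1 phiP.1).

Lemma preserving_ge0_integral (h : T2 -> \bar R) : measurable_fun setT h ->
  (forall y, 0 <= h y)%E -> (\int[m2]_y h y = \int[m1]_x h (phi x))%E.
Proof.
move=> mh h0; rewrite (eq_measure_integral push) => [|A mA _]; last first.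
  by rewrite -(phiP.2 _ mA).
by rewrite ge0_integral_pushforward//; exact: phiP.1.
Qed.

Lemma preserving_has_mean (h : T2 -> R) v :
  has_mean m2 h v -> has_mean m1 (fun x => h (phi x)) v.
Proof.
move=> [hi hv]; have mh := has_mean_measurable (has_mean_int hi).
have i1 : m1.-integrable setT (EFin \o (fun x => h (phi x))).
  apply/integrableP; split.
    by apply/measurable_EFinP; apply: measurableT_comp => //; exact: phiP.1.
  have /integrableP[_] := hi.
  rewrite preserving_ge0_integral//.
  by apply: measurableT_comp => //; exact/measurable_EFinP.
split=> //; rewrite -hv; congr fine.
rewrite [RHS](eq_measure_integral push) => [|A mA _]; last first.
  by rewrite -(phiP.2 _ mA).
rewrite (integral_pushforward phiP.1 _ _ measurableT)//.
exact/measurable_EFinP.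
Qed.

Lemma preserving_sq_integrable (h : T2 -> R) :
  sq_integrable m2 h -> sq_integrable m1 (fun x => h (phi x)).
Proof.
move=> [mh hi]; split; first by apply: measurableT_comp => //; exact: phiP.1.
exact: (preserving_has_mean (has_mean_int hi)).1.
Qed.

End measure_preserving.

(** The inner integral may fail to exist on a null set, where [Rintegral] takes
    a default value; this does not affect the outer mean. *)
Lemma has_mean_fubini d1 d2 (T1 : measurableType d1) (T2 : measurableType d2)
  (R : realType) (P1 : probability T1 R) (P2 : probability T2 R)
  (h : T1 * T2 -> R) v : has_mean (P1 \x P2)%E h v ->
  (\forall x \ae P1, P2.-integrable setT (EFin \o (fun y => h (x, y)))) /\
  has_mean P1 (fun x => \int[P2]_y h (x, y)) v.
Proof.
move=> [hi hv]; have ai := ae_integrable1 hi; split=> //.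
have Fi := integrable_fubini_F hi.
have FE : ae_eq P1 setT (fubini_F P2 (EFin \o h))
    (EFin \o (fun x => \int[P2]_y h (x, y))).
  apply: filterS ai => x hxi _ /=; rewrite /fubini_F /Rintegral fineK//.
  exact: integrable_fin_num.
have mF : measurable_fun setT (fun x => \int[P2]_y h (x, y)).
  apply: (measurableT_comp (fine_measurable _)) => //.
  exact: (measurable_int _ Fi).
split; first by apply: ae_eq_integrable Fi => //; exact/measurable_EFinP.
rewrite -hv /Rintegral -(integral12_prod_meas1 hi); congr fine.
apply/esym/ae_eq_integral => //; first exact: (measurable_int _ Fi).
exact/measurable_EFinP.
Qed.
(** * Product measures on row vectors *)

Section row_vectors.
Context (R : realType) (n : nat).
Implicit Types (w : 'rV[R]_n) (i : 'I_n).

Lemma measurable_coord i :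
  measurable_fun setT (fun w : 'rV[R]_n => w ord0 i : measurableTypeR R).
Proof.
move=> _ Y mY; rewrite setTI; apply: sub_sigma_algebra => /=.
rewrite -bigcup_seq/=; exists i => /=; first by rewrite mem_index_enum.
by exists Y => //; rewrite setTI.
Qed.

Lemma measurable_rV d (T : measurableType d) (phi : T -> 'rV[R]_n) :
  (forall i, measurable_fun setT
     (fun z => phi z ord0 i : measurableTypeR R)) ->
  measurable_fun setT phi.
Proof.
move=> mphi; apply: (measurability
  (\big[setU/set0]_(i < n) preimage_set_system [set: 'rV[R]_n]
     (fun w => w ord0 i : measurableTypeR R) measurable)) => //.
move=> _ [B + <-]; rewrite -bigcup_seq/= => -[i _ [C mC <-]].
by rewrite setTI; exact: mphi.
Qed.

Definition box (B : 'I_n -> set (measurableTypeR R)) : set 'rV[R]_n :=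
  [set w | forall k, B k (w ord0 k)].

Lemma measurable_box B : (forall k, measurable (B k)) -> measurable (box B).
Proof.
move=> mB; rewrite (_ : box B = \bigcap_(k in [set: 'I_n])
    ((fun w => w ord0 k) @^-1` B k)); last first.
  by apply/seteqP; split=> w /= h k; [move=> _; exact: h|exact: (h k I)].
apply: fin_bigcap_measurable => [|k _]; first exact: finite_finset.
by rewrite -[X in measurable X]setTI; exact: measurable_coord.
Qed.

Lemma rV_measure_unique (m1 m2 : {measure set 'rV[R]_n -> \bar R}) :
  (m1 setT < +oo)%E ->
  (forall B, (forall k, measurable (B k)) -> m1 (box B) = m2 (box B)) ->
  forall A, measurable A -> m1 A = m2 A.
Proof.
move=> m1oo m12.
have boxT : box (fun=> setT) = setT by apply/seteqP.
apply: (measure_unique [set box B | B in [set B | forall k, measurable (B k)]]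
  (fun=> setT)) => //.
- apply/seteqP; split.
    apply: smallest_sub; first exact: smallest_sigma_algebra.
    move=> A; rewrite -bigcup_seq/= => -[i _ [C mC <-]].
    apply: sub_sigma_algebra; exists (fun k => if k == i then C else setT).
      by move=> k; case: ifP.
    rewrite setTI; apply/seteqP; split=> w /=.
      by move=> /(_ i); rewrite eqxx.
    by move=> Cw k; case: ifP => // /eqP ->.
  apply: smallest_sub; first exact: sigma_algebra_measurable.
  by move=> _ [B mB <-]; exact: measurable_box.
- move=> _ _ [B mB <-] [C mC <-]; exists (fun k => B k `&` C k).
    by move=> k; exact: measurableI.
  by apply/seteqP; split=> w /= h; [split=> k; case: (h k)|move=> k; case: h].
- by move=> _; exists (fun=> setT).
- by rewrite bigcup_const.
- by move=> _ [B mB <-]; exact: m12.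
Qed.

Variables (nu : 'I_n -> probability (measurableTypeR R) R).
Variables (th : probability 'rV[R]_n R).
Hypothesis thP : is_product_measure nu th.

(** All the identities in law below are instances of this criterion: it is
    enough to compute the preimage of a box, which is again a box. *)
Lemma preserving_product d (T : measurableType d) (m : {measure set T -> \bar R})
    (phi : T -> 'rV[R]_n) : measurable_fun setT phi ->
  (forall B, (forall k, measurable (B k)) ->
    m (phi @^-1` box B) = (\prod_(k < n) nu k (B k))%E) ->
  preserving m th phi.
Proof.
move=> mphi phiP; split=> // A mA.
pose push : {measure set _ -> \bar R} := @Measure.clone _ _ _ _
  (measure_function_pushforward__canonical__measure_function_Measure m mphi).
apply/esym; rewrite -[RHS]/(push A); apply: rV_measure_unique => //.
  by rewrite [ltLHS](probability_setT th) ltry.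
by move=> B mB; rewrite [LHS]thP// -phiP.
Qed.

Definition upd i (s : R) w : 'rV[R]_n :=
  \row_j (if j == i then s else w ord0 j).

Definition mix (S : pred 'I_n) w' w : 'rV[R]_n :=
  \row_j (if S j then w' ord0 j else w ord0 j).

Lemma measurable_upd i :
  measurable_fun setT (fun z : 'rV[R]_n * measurableTypeR R => upd i z.2 z.1).
Proof.
apply: measurable_rV => j.
have [->|ji] := eqVneq j i.
  rewrite (_ : (fun _ => _) = snd)//.
  by apply/funext => z; rewrite mxE eqxx.
rewrite (_ : (fun _ => _) = (fun w : 'rV[R]_n => w ord0 j) \o fst).
  by apply: measurableT_comp => //; exact: measurable_coord.
by apply/funext => z; rewrite mxE (negbTE ji).
Qed.

Lemma measurable_mix S :
  measurable_fun setT (fun z : 'rV[R]_n * 'rV[R]_n => mix S z.1 z.2).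
Proof.
apply: measurable_rV => j; case Sj : (S j).
  rewrite (_ : (fun _ => _) = (fun w : 'rV[R]_n => w ord0 j) \o fst).
    by apply: measurableT_comp => //; exact: measurable_coord.
  by apply/funext => z; rewrite mxE Sj.
rewrite (_ : (fun _ => _) = (fun w : 'rV[R]_n => w ord0 j) \o snd).
  by apply: measurableT_comp => //; exact: measurable_coord.
by apply/funext => z; rewrite mxE Sj.
Qed.

Lemma preserving_coord i : preserving th (nu i) (fun w => w ord0 i).
Proof.
split; first exact: measurable_coord.
move=> B mB; pose C k := if k == i then B else setT.
rewrite (_ : _ @^-1` _ = box C); last first.
  apply/seteqP; split=> w; rewrite /box/C /=; last by move=> /(_ i); rewrite eqxx.
  by move=> Bw k; case: eqP => // ->.
rewrite [LHS]thP; last by move=> k; rewrite /C; case: ifP.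
rewrite (bigD1 i)//= /C eqxx big1 ?mule1// => k /negbTE ->.
exact: probability_setT.
Qed.

(** Redrawing one coordinate independently does not change the law: this is
    Fubini for one coordinate, in a form that stays in the space of row vectors
    and so needs no splitting of the dimension. *)
Lemma preserving_upd i :
  preserving (th \x nu i)%E th (fun z => upd i z.2 z.1).
Proof.
apply: preserving_product; first exact: measurable_upd.
move=> B mB; pose C k := if k == i then setT else B k.
have mC k : measurable (C k) by rewrite /C; case: ifP.
rewrite (_ : _ @^-1` _ = box C `*` B i); last first.
  apply/seteqP; split=> -[w s]; rewrite /box/C /=.
    move=> h; split=> [k|]; last by have := h i; rewrite mxE eqxx.
    by have := h k; rewrite mxE; case: eqP.
  by move=> [h Bs] k; have := h k; rewrite mxE; case: eqP => // ->.
rewrite [LHS]product_measure1E//; last exact: measurable_box.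
rewrite [X in (X * _)%E]thP// (bigD1 i)//= (bigD1 (P := xpredT) i)//=.
rewrite {1}/C eqxx probability_setT mul1e muleC; congr (_ * _)%E.
by apply: eq_bigr => k /negbTE ki; rewrite /C ki.
Qed.

(** Fubini for an arbitrary block [S] of coordinates, in the same style. *)
Lemma preserving_mix S :
  preserving (th \x th)%E th (fun z => mix S z.1 z.2).
Proof.
apply: preserving_product; first exact: measurable_mix.
move=> B mB; pose C k := if S k then B k else setT.
pose D k := if S k then setT else B k.
have mC k : measurable (C k) by rewrite /C; case: ifP.
have mD k : measurable (D k) by rewrite /D; case: ifP.
rewrite (_ : _ @^-1` _ = box C `*` box D); last first.
  apply/seteqP; split=> -[w w']; rewrite /box/C/D /=.
    by move=> h; split=> k; have := h k; rewrite mxE; case: (S k).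
  by move=> [h h'] k; have := h k; have := h' k; rewrite mxE; case: (S k).
rewrite [LHS]product_measure1E//; try exact: measurable_box.
rewrite [X in (X * _)%E]thP// [X in (_ * X)%E]thP// -big_split/=.
apply: eq_bigr => k _; rewrite /C/D.
by case: (S k); rewrite probability_setT ?mule1 ?mul1e.
Qed.

Lemma preserving_opp :
  (forall i (B : set (measurableTypeR R)), measurable B ->
    nu i ((-%R : R -> R) @^-1` B) = nu i B) ->
  preserving th th -%R.
Proof.
move=> nuN; apply: preserving_product.
  apply: measurable_rV => i.
  rewrite (_ : (fun _ => _) = -%R \o (fun w : 'rV[R]_n => w ord0 i)).
    by apply: measurableT_comp => //; exact: measurable_coord.
  by apply/funext => w; rewrite mxE.
move=> B mB; rewrite (_ : _ @^-1` _ = box (fun k => -%R @^-1` B k)); last first.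
  by apply/seteqP; split=> w h k /=; have := h k; rewrite mxE.
rewrite [LHS]thP; last first.
  move=> k; rewrite -[X in measurable X]setTI.
  exact: (@oppr_measurable R setT measurableT _ (mB k)).
by apply: eq_bigr => k _; exact: nuN.
Qed.

End row_vectors.

Definition reindex_row (R : realType) n d (sg : 'I_d -> 'I_n)
  (w : 'rV[R]_n) : 'rV[R]_d := \row_i w ord0 (sg i).

(** Injectivity says that no coordinate is used twice; this is what makes the
    selected coordinates independent. *)
Lemma preserving_reindex (R : realType) n d (sg : 'I_d -> 'I_n)
    (nu : 'I_n -> probability (measurableTypeR R) R)
    (th : probability 'rV[R]_n R) (th' : probability 'rV[R]_d R) :
  injective sg -> is_product_measure nu th ->
  is_product_measure (nu \o sg) th' -> preserving th th' (reindex_row sg).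
Proof.
move=> sgI thP th'P; apply: (preserving_product th'P).
  apply: measurable_rV => i.
  rewrite (_ : (fun _ => _) = (fun w : 'rV[R]_n => w ord0 (sg i))).
    exact: measurable_coord.
  by apply/funext => w; rewrite mxE.
move=> B mB.
(* The constraint on coordinate [j] is the one of its only preimage by [sg]. *)
pose C j := if [pick i | sg i == j] is Some i then B i else setT.
rewrite (_ : _ @^-1` _ = box C); last first.
  apply/seteqP; split=> w; rewrite /box/C /= => h k.
    case: pickP => // i /eqP <-; by have := h i; rewrite mxE.
  have := h (sg k); case: pickP => [i /eqP/sgI ->|/(_ k)]; last by rewrite eqxx.
  by rewrite mxE.
rewrite [LHS]thP; last by move=> k; rewrite /C; case: pickP.
rewrite [RHS](partition_big sg xpredT)//=; apply: eq_bigr => j _.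
rewrite /C; case: pickP => [i /eqP <-|h].
  by rewrite (big_pred1 i)// => k; rewrite /= (inj_eq sgI).
by rewrite big1 ?probability_setT// => i; rewrite h.
Qed.

Section image_probability.
Context d1 d2 (T1 : measurableType d1) (T2 : measurableType d2) (R : realType).
Variables (m : {measure set T1 -> \bar R}) (phi : T1 -> T2).
Hypotheses (mT : m setT = 1%E) (mphi : measurable_fun setT phi).

Lemma image_probability : exists P : probability T2 R,
  forall A, P A = m (phi @^-1` A).
Proof.
pose push : {measure set _ -> \bar R} := @Measure.clone _ _ _ _
  (measure_function_pushforward__canonical__measure_function_Measure m mphi).
have push1 : push setT = 1%E by rewrite -mT.
pose P : probability T2 R := HB.pack (Measure.sort push)
  (Measure_isProbability.Build _ _ _ (Measure.sort push) push1).
by exists P.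
Qed.

End image_probability.

Lemma product_measure_exists (R : realType) n
    (nu : 'I_n -> probability (measurableTypeR R) R) :
  exists th : probability 'rV[R]_n R, is_product_measure nu th.
Proof.
elim: n nu => [|n IH] nu.
  exists (\d_ (0 : 'rV[R]_0)) => B mB.
  by rewrite big_ord0 [LHS]diracE mem_set//= => -[].
have [th thP] := IH (nu \o lift ord0).
pose phi (z : measurableTypeR R * 'rV[R]_n) : 'rV[R]_n.+1 :=
  \row_i (if unlift ord0 i is Some j then z.2 ord0 j else z.1).
have mphi : measurable_fun setT phi.
  apply: measurable_rV => i.
  case: (unliftP ord0 i) => [j ->|->].
    rewrite (_ : (fun _ => _) = (fun w : 'rV[R]_n => w ord0 j) \o snd).
      by apply: measurableT_comp => //; exact: measurable_coord.
    by apply/funext => z; rewrite mxE liftK.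
  rewrite (_ : (fun _ => _) = fst)//.
  by apply/funext => z; rewrite mxE unlift_none.
have m1 : (nu ord0 \x th)%E setT = 1%E.
  rewrite -setXTT [LHS]product_measure1E//.
  by rewrite [X in (X * _)%E]probability_setT mul1e [LHS]probability_setT.
have [P PE] := image_probability m1 mphi.
exists P => B mB; rewrite PE big_ord_recl.
rewrite (_ : _ @^-1` _ = B ord0 `*` box (fun k => B (lift ord0 k))); last first.
  apply/seteqP; split=> -[t x]; rewrite /box /=.
    move=> h; split=> [|k]; first by have := h ord0; rewrite mxE unlift_none.
    by have := h (lift ord0 k); rewrite mxE liftK.
  by move=> [h0 h] k; rewrite mxE; case: (unliftP ord0 k) => [j ->|->].
rewrite [LHS]product_measure1E//; last exact: measurable_box.
by rewrite [X in (_ * X)%E]thP.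
Qed.
(** * The four functions theorem on the line *)

Section four_functions_line.
Local Open Scope ereal_scope.
Context (R : realType).
Implicit Types a b c d : \bar R.

(** From [(c - a) * (c - b) >= 0] one gets [c * (a + b) <= c ^ 2 + a * b], which
    is at most [c * (c + d)]. *)
Lemma add_le_of_mul_le a b c d : 0 <= a -> 0 <= b -> 0 <= c -> 0 <= d ->
  a <= c -> b <= c -> a * b <= c * d -> a + b <= c + d.
Proof.
case: d => [d| |]//; last first.
  by case: c => // [c|] *; rewrite ?addey ?leey.
case: c => [c| |]//; last by move=> *; rewrite addye ?leey.
case: a => [a| |]//; case: b => [b| |]//.
rewrite -!EFinM -!EFinD !lee_fin => a0 b0 c0 d0 ac bc abcd.
have [c_eq0|c_gt0] := eqVneq c 0%R; first by nra.
have {}c_gt0 : (0 < c)%R by rewrite lt_def c_gt0.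
by rewrite -(ler_pM2l c_gt0); nra.
Qed.

Lemma double_le a b : a + a <= b + b -> a <= b.
Proof.
move=> h; rewrite leNgt; apply/negP => ba.
by have := lt_le_trans (lteD ba ba) h; rewrite ltxx.
Qed.

Variables (P : probability (measurableTypeR R) R).
Variables f1 f2 f3 f4 : measurableTypeR R -> \bar R.
Hypotheses (mf1 : measurable_fun setT f1) (mf2 : measurable_fun setT f2)
  (mf3 : measurable_fun setT f3) (mf4 : measurable_fun setT f4).
Hypotheses (f1_ge0 : forall s, 0 <= f1 s) (f2_ge0 : forall s, 0 <= f2 s)
  (f3_ge0 : forall s, 0 <= f3 s) (f4_ge0 : forall s, 0 <= f4 s).
Hypothesis f1234 : forall s t : R,
  f1 s * f2 t <= f3 (Num.max s t) * f4 (Num.min s t).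

(** For [s <= t] this is [add_le_of_mul_le] where [c] is [f3 t * f4 s] and [d]
    is [f3 s * f4 t].  The product of the two terms on the left is bounded by
    applying the hypothesis on the diagonal, at [(s, s)] and at [(t, t)]. *)
Let symmetrized s t : f1 s * f2 t + f2 s * f1 t <= f3 s * f4 t + f4 s * f3 t.
Proof.
have E (a b c d : \bar R) : a * b * (c * d) = a * d * (c * b).
  by rewrite muleACA (muleC b d) muleACA.
wlog st : s t / (s <= t)%R => [hw|].
  have [/ltW /hw//|/hw] := ltP s t.
  rewrite addeC (muleC (f2 t)) (muleC (f1 t)).
  by rewrite [in X in _ <= X]addeC (muleC (f4 t)) (muleC (f3 t)).
rewrite [in leRHS]addeC; apply: add_le_of_mul_le; rewrite ?mule_ge0//.
- by have := f1234 s t; rewrite max_r// min_l// muleC [leRHS]muleC.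
- by have := f1234 t s; rewrite max_l// min_r// muleC [leRHS]muleC.
- have := f1234 s s; have := f1234 t t; rewrite !maxxx !minxx => h1 h2.
  rewrite [X in _ * X <= _]muleC E [leRHS](_ : _ = f3 s * f4 s * (f3 t * f4 t)).
    by apply: lee_pmul => //; rewrite mule_ge0.
  by rewrite (muleC (f4 s)) E muleC.
Qed.

Let I f := \int[P]_s f s.

Let mZ (f : measurableTypeR R -> \bar R) c : measurable_fun setT f ->
  measurable_fun setT (fun s => f s * c).
Proof. by move=> mf; apply: emeasurable_funM. Qed.

Let integral_comb (u v : measurableTypeR R -> \bar R) (c d : \bar R) :
  measurable_fun setT u -> measurable_fun setT v ->
  (forall s, 0 <= u s) -> (forall s, 0 <= v s) -> 0 <= c -> 0 <= d ->
  I (fun s => u s * c + v s * d) = I u * c + I v * d.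
Proof.
move=> mu mv u0 v0 c0 d0; rewrite /I ge0_integralD//.
- by rewrite !ge0_integralZr.
- by move=> s _; rewrite mule_ge0.
- exact: mZ.
- by move=> s _; rewrite mule_ge0.
- exact: mZ.
Qed.

Let le_integral_comb (u v u' v' : measurableTypeR R -> \bar R)
    (c d c' d' : \bar R) :
  measurable_fun setT u -> measurable_fun setT v ->
  measurable_fun setT u' -> measurable_fun setT v' ->
  (forall s, 0 <= u s) -> (forall s, 0 <= v s) ->
  (forall s, 0 <= u' s) -> (forall s, 0 <= v' s) ->
  0 <= c -> 0 <= d -> 0 <= c' -> 0 <= d' ->
  (forall s, u s * c + v s * d <= u' s * c' + v' s * d') ->
  I u * c + I v * d <= I u' * c' + I v' * d'.
Proof.
move=> *; rewrite -!integral_comb//; apply: ge0_le_integral => //.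
- by move=> s _; rewrite adde_ge0 ?mule_ge0.
- by apply: emeasurable_funD; exact: mZ.
- by apply: emeasurable_funD; exact: mZ.
Qed.

(** Integrating the symmetrized inequality in both variables gives twice the
    claim. *)
Lemma four_functions_line : I f1 * I f2 <= I f3 * I f4.
Proof.
have I0 f : (forall s, 0 <= f s) -> 0 <= I f.
  by move=> f0; exact: integral_ge0.
have step s : f1 s * I f2 + f2 s * I f1 <= f3 s * I f4 + f4 s * I f3.
  have := @le_integral_comb f2 f1 f4 f3 (f1 s) (f2 s) (f3 s) (f4 s)
    mf2 mf1 mf4 mf3 f2_ge0 f1_ge0 f4_ge0 f3_ge0
    (f1_ge0 s) (f2_ge0 s) (f3_ge0 s) (f4_ge0 s) => h.
  rewrite (muleC (f1 s)) (muleC (f2 s)) (muleC (f3 s)) (muleC (f4 s)).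
  apply: h => t; rewrite (muleC (f2 t)) (muleC (f1 t)) (muleC (f4 t)).
  by rewrite (muleC (f3 t)); exact: symmetrized.
have := @le_integral_comb f1 f2 f3 f4 (I f2) (I f1) (I f4) (I f3)
    mf1 mf2 mf3 mf4 f1_ge0 f2_ge0 f3_ge0 f4_ge0
    (I0 _ f2_ge0) (I0 _ f1_ge0) (I0 _ f4_ge0) (I0 _ f3_ge0) step.
by rewrite (muleC (I f2)) (muleC (I f4)) => /double_le.
Qed.

End four_functions_line.

(** * The lattice of row vectors *)

Section lattice.
Context (R : realType) (n : nat).
Implicit Types (w x y : 'rV[R]_n) (i j : 'I_n).

Definition joinv x y : 'rV[R]_n := \row_i Num.max (x ord0 i) (y ord0 i).
Definition meetv x y : 'rV[R]_n := \row_i Num.min (x ord0 i) (y ord0 i).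
Definition le_row x y := forall i, x ord0 i <= y ord0 i.

Lemma le_row_joinl x y : le_row x (joinv x y).
Proof. by move=> i; rewrite mxE le_max lexx. Qed.

Lemma le_row_joinr x y : le_row y (joinv x y).
Proof. by move=> i; rewrite mxE le_max lexx orbT. Qed.

Lemma le_row_meetl x y : le_row (meetv x y) x.
Proof. by move=> i; rewrite mxE ge_min lexx. Qed.

Lemma le_row_meetr x y : le_row (meetv x y) y.
Proof. by move=> i; rewrite mxE ge_min lexx orbT. Qed.

Lemma upd_join i (s t : R) x y :
  joinv (upd i s x) (upd i t y) = upd i (Num.max s t) (joinv x y).
Proof. by apply/rowP => j; rewrite !mxE; case: eqP. Qed.

Lemma upd_meet i (s t : R) x y :
  meetv (upd i s x) (upd i t y) = upd i (Num.min s t) (meetv x y).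
Proof. by apply/rowP => j; rewrite !mxE; case: eqP. Qed.

Lemma updK i (s t : R) w : upd i s (upd i t w) = upd i s w.
Proof. by apply/rowP => j; rewrite !mxE; case: eqP. Qed.

Lemma updC i j (s t : R) w : i != j ->
  upd i s (upd j t w) = upd j t (upd i s w).
Proof.
move=> /eqP ij; apply/rowP => k; rewrite !mxE.
by case: eqP => // ->; case: eqP.
Qed.

Definition free_of (T : Type) (f : 'rV[R]_n -> T) i :=
  forall s w, f (upd i s w) = f w.

Lemma free_of_all (T : Type) (f : 'rV[R]_n -> T) :
  (forall i, free_of f i) -> forall x y, f x = f y.
Proof.
move=> ff x y.
suff h (l : seq 'I_n) :
    f (\row_j (if j \in l then x ord0 j else y ord0 j)) = f y.
  rewrite -(h (enum 'I_n)); congr f; apply/rowP => j.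
  by rewrite mxE mem_enum.
elim: l => [|i l <-]; first by congr f; apply/rowP => j; rewrite mxE.
rewrite -[RHS](ff i (x ord0 i)); congr f; apply/rowP => j.
by rewrite !mxE in_cons; case: eqP => // ->.
Qed.

End lattice.

(** * The four functions theorem in several variables, and FKG *)

Section four_functions.
Context (R : realType) (n : nat).
Variables (nu : 'I_n -> probability (measurableTypeR R) R).
Variables (th : probability 'rV[R]_n R).
Hypothesis thP : is_product_measure nu th.
Implicit Types (f : 'rV[R]_n -> \bar R).
Local Open Scope ereal_scope.

Definition integrate_coord i f : 'rV[R]_n -> \bar R :=
  fun w => \int[nu i]_s f (upd i s w).

Lemma measurable_upd_scalar i (w : 'rV[R]_n) :
  measurable_fun setT (fun s : measurableTypeR R => upd i s w).
Proof.
apply: measurable_rV => j; have [->|ji] := eqVneq j i.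
  by rewrite (_ : (fun _ => _) = id)//; apply/funext => s; rewrite mxE eqxx.
rewrite (_ : (fun _ => _) = (fun=> w ord0 j))//.
by apply/funext => s; rewrite mxE (negbTE ji).
Qed.

Lemma integrate_coord_ge0 i f : (forall w, 0 <= f w) ->
  forall w, 0 <= integrate_coord i f w.
Proof. by move=> f0 w; exact: integral_ge0. Qed.

Lemma measurable_integrate_coord i f : measurable_fun setT f ->
  (forall w, 0 <= f w) -> measurable_fun setT (integrate_coord i f).
Proof.
move=> mf f0.
pose F (z : 'rV[R]_n * measurableTypeR R) := f (upd i z.2 z.1).
have mF : measurable_fun setT F.
  by apply: measurableT_comp => //; exact: measurable_upd.
exact: (measurable_fun_fubini_tonelli_F F mF (fun z => f0 _)).
Qed.

Lemma integral_integrate_coord i f : measurable_fun setT f ->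
  (forall w, 0 <= f w) ->
  \int[th]_w f w = \int[th]_w integrate_coord i f w.
Proof.
move=> mf f0; rewrite (preserving_ge0_integral (preserving_upd thP i))//.
pose F (z : 'rV[R]_n * measurableTypeR R) := f (upd i z.2 z.1).
have mF : measurable_fun setT F.
  by apply: measurableT_comp => //; exact: measurable_upd.
exact: (fubini_tonelli1 F mF (fun z => f0 _)).
Qed.

Lemma free_of_integrate_coord i f : free_of (integrate_coord i f) i.
Proof.
by move=> s w; apply: eq_integral => t _; rewrite updK.
Qed.

Lemma free_of_integrate_coordW i j f :
  free_of f j -> free_of (integrate_coord i f) j.
Proof.
move=> fj s w; have [->|ij] := eqVneq i j; first exact: free_of_integrate_coord.
by apply: eq_integral => t _; rewrite updC.
Qed.

(** Integrating out one coordinate preserves the hypothesis, by the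
    one-dimensional theorem, and leaves the integrals unchanged.  When no
    coordinate is left the functions are constant.  Values in the extended
    reals are needed because partial integrals may be infinite at some points. *)
Lemma four_functions f1 f2 f3 f4 :
  measurable_fun setT f1 -> measurable_fun setT f2 ->
  measurable_fun setT f3 -> measurable_fun setT f4 ->
  (forall w, 0 <= f1 w) -> (forall w, 0 <= f2 w) ->
  (forall w, 0 <= f3 w) -> (forall w, 0 <= f4 w) ->
  (forall x y, f1 x * f2 y <= f3 (joinv x y) * f4 (meetv x y)) ->
  (\int[th]_w f1 w) * (\int[th]_w f2 w) <=
  (\int[th]_w f3 w) * (\int[th]_w f4 w).
Proof.
have : forall i, i \notin enum 'I_n ->
  [/\ free_of f1 i, free_of f2 i, free_of f3 i & free_of f4 i].
  by move=> i; rewrite mem_enum.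
elim: (enum 'I_n) f1 f2 f3 f4 => [|i l IH] f1 f2 f3 f4 ff
  mf1 mf2 mf3 mf4 f10 f20 f30 f40 f1234.
  have fE f : (forall i, free_of f i) -> \int[th]_w f w = f 0%R.
    move=> fi; under eq_integral do rewrite (free_of_all fi _ 0%R).
    by rewrite integral_cst//= [X in _ * X](probability_setT th) mule1.
  have [h1 h2 h3 h4] : [/\ forall i, free_of f1 i, forall i, free_of f2 i,
      forall i, free_of f3 i & forall i, free_of f4 i].
    by split=> i; case: (ff i).
  rewrite !fE// (le_trans (f1234 0%R 0%R))//.
  by rewrite (free_of_all h3 _ 0%R) (free_of_all h4 _ 0%R).
rewrite (integral_integrate_coord i mf1 f10) (integral_integrate_coord i mf2 f20).
rewrite (integral_integrate_coord i mf3 f30) (integral_integrate_coord i mf4 f40).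
apply: IH; try exact: measurable_integrate_coord;
  try exact: integrate_coord_ge0.
  move=> j jl; have [->|ji] := eqVneq j i.
    by split; exact: free_of_integrate_coord.
  have jil : j \notin i :: l by rewrite in_cons negb_or ji.
  have [h1 h2 h3 h4] := ff j jil.
  by split; exact: free_of_integrate_coordW.
move=> x y; apply: four_functions_line => //;
  try (by apply: measurableT_comp => //; exact: measurable_upd_scalar).
by move=> s t; rewrite -upd_join -upd_meet.
Qed.

End four_functions.

Section fkg.
Context (R : realType) (n : nat).
Variables (nu : 'I_n -> probability (measurableTypeR R) R).
Variables (th : probability 'rV[R]_n R).
Hypothesis thP : is_product_measure nu th.
Implicit Types (f F p q : 'rV[R]_n -> R).

Lemma four_means f1 f2 f3 f4 v1 v2 v3 v4 :
  has_mean th f1 v1 -> has_mean th f2 v2 ->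
  has_mean th f3 v3 -> has_mean th f4 v4 ->
  (forall w, 0 <= f1 w) -> (forall w, 0 <= f2 w) ->
  (forall w, 0 <= f3 w) -> (forall w, 0 <= f4 w) ->
  (forall x y, f1 x * f2 y <= f3 (joinv x y) * f4 (meetv x y)) ->
  v1 * v2 <= v3 * v4.
Proof.
move=> h1 h2 h3 h4 p1 p2 p3 p4 f1234.
have E f v : has_mean th f v -> (\int[th]_w (f w)%:E = v%:E)%E.
  by move=> [fi <-]; rewrite /Rintegral fineK//; exact: integrable_fin_num.
rewrite -lee_fin !EFinM -(E _ _ h1) -(E _ _ h2) -(E _ _ h3) -(E _ _ h4).
apply: (four_functions thP) => //;
  try (apply/measurable_EFinP; apply: has_mean_measurable; eassumption);
  by move=> *; rewrite ?lee_fin// -!EFinM lee_fin.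
Qed.

Definition log_supermodular F := forall x y,
  F x * F y <= F (joinv x y) * F (meetv x y).
Definition increasing p := forall x y, le_row x y -> p x <= p y.

Lemma weighted_four_means F u1 u2 u3 u4 v1 v2 v3 v4 :
  (forall w, 0 <= F w) -> log_supermodular F ->
  has_mean th (fun w => F w * u1 w) v1 -> has_mean th (fun w => F w * u2 w) v2 ->
  has_mean th (fun w => F w * u3 w) v3 -> has_mean th (fun w => F w * u4 w) v4 ->
  (forall w, 0 <= u1 w) -> (forall w, 0 <= u2 w) ->
  (forall w, 0 <= u3 w) -> (forall w, 0 <= u4 w) ->
  (forall x y, u1 x * u2 y <= u3 (joinv x y) * u4 (meetv x y)) ->
  v1 * v2 <= v3 * v4.
Proof.
move=> F0 FF h1 h2 h3 h4 p1 p2 p3 p4 u1234.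
apply: (four_means h1 h2 h3 h4) => [w|w|w|w|x y]; rewrite ?mulr_ge0//.
by rewrite mulrACA [leRHS]mulrACA ler_pM// mulr_ge0.
Qed.

(** Applied to nonnegative weights, the four functions theorem gives the
    inequality for nonnegative [p] and [q].  The signed case needs no truncation
    argument: split [p] and [q] into positive and negative parts.  The negative
    part of an increasing function is decreasing, and each of the four products
    of parts obeys an instance of the four functions theorem, with the two
    mixed products reversed. *)
Lemma fkg F p q a b c e :
  (forall w, 0 <= F w) -> log_supermodular F ->
  measurable_fun setT p -> measurable_fun setT q -> increasing p -> increasing q ->
  has_mean th F a -> has_mean th (fun w => F w * p w) b ->
  has_mean th (fun w => F w * q w) c ->
  has_mean th (fun w => F w * (p w * q w)) e ->
  b * c <= a * e.
Proof.
move=> F0 FF mp mq ip iq Fa Fb Fc Fe.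
have mF := has_mean_measurable Fa.
pose pos (u : R) := Num.max u 0; pose neg (u : R) := Num.max (- u) 0.
have pos0 u : 0 <= pos u by rewrite le_max lexx orbT.
have neg0 u : 0 <= neg u by rewrite le_max lexx orbT.
have posneg u : u = pos u - neg u.
  rewrite /pos/neg; have [u0|/ltW u0] := leP u 0.
    by rewrite max_l ?oppr_ge0// sub0r opprK.
  by rewrite max_r ?oppr_le0// subr0.
have pos_le u : pos u <= `|u|.
  by rewrite /pos ge_max ler_norm normr_ge0.
have neg_le u : neg u <= `|u|.
  by rewrite /neg -normrN ge_max ler_norm normr_ge0.
have mpos (u : 'rV[R]_n -> R) :
    measurable_fun setT u -> measurable_fun setT (fun w => pos (u w)).
  by move=> mu; apply: measurable_maxr.
have mneg (u : 'rV[R]_n -> R) :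
    measurable_fun setT u -> measurable_fun setT (fun w => neg (u w)).
  by move=> mu; apply: measurable_maxr => //; exact: measurableT_comp.
have posI u v : u <= v -> pos u <= pos v.
  by move=> uv; rewrite /pos ge_max le_max uv/= le_max lexx orbT.
have negD u v : u <= v -> neg v <= neg u.
  by move=> uv; rewrite /neg ge_max le_max lerN2 uv/= le_max lexx orbT.
have dom (u v : 'rV[R]_n -> R) z :
    has_mean th (fun w => F w * u w) z -> measurable_fun setT v ->
    (forall w, 0 <= v w) -> (forall w, v w <= `|u w|) ->
    has_mean th (fun w => F w * v w) (\int[th]_w (F w * v w)).
  move=> [ui _] mv v0 vu; apply: has_mean_int; apply: le_integrable ui => //.
    by apply/measurable_EFinP; exact: measurable_funM.
  move=> w _ /=; rewrite lee_fin !normrM ler_wpM2l//.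
  by rewrite ger0_norm.
have bp := dom _ _ _ Fb (mpos _ mp) (fun=> pos0 _) (fun=> pos_le _).
have bn := dom _ _ _ Fb (mneg _ mp) (fun=> neg0 _) (fun=> neg_le _).
have cp := dom _ _ _ Fc (mpos _ mq) (fun=> pos0 _) (fun=> pos_le _).
have cn := dom _ _ _ Fc (mneg _ mq) (fun=> neg0 _) (fun=> neg_le _).
have prod0 (u v : R -> R) : (forall t, 0 <= u t) -> (forall t, 0 <= v t) ->
    forall w, 0 <= u (p w) * v (q w).
  by move=> u0 v0 w; rewrite mulr_ge0.
have prod_le (u v : R -> R) : (forall t, 0 <= u t) -> (forall t, 0 <= v t) ->
    (forall t, u t <= `|t|) -> (forall t, v t <= `|t|) ->
    forall w, u (p w) * v (q w) <= `|p w * q w|.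
  by move=> u0 v0 ul vl w; rewrite normrM ler_pM.
have epp := dom _ _ _ Fe (measurable_funM (mpos _ mp) (mpos _ mq))
  (prod0 _ _ pos0 pos0) (prod_le _ _ pos0 pos0 pos_le pos_le).
have epn := dom _ _ _ Fe (measurable_funM (mpos _ mp) (mneg _ mq))
  (prod0 _ _ pos0 neg0) (prod_le _ _ pos0 neg0 pos_le neg_le).
have enp := dom _ _ _ Fe (measurable_funM (mneg _ mp) (mpos _ mq))
  (prod0 _ _ neg0 pos0) (prod_le _ _ neg0 pos0 neg_le pos_le).
have enn := dom _ _ _ Fe (measurable_funM (mneg _ mp) (mneg _ mq))
  (prod0 _ _ neg0 neg0) (prod_le _ _ neg0 neg0 neg_le neg_le).
have F1 : has_mean th (fun w => F w * 1) a.
  by apply: eq_has_mean Fa => // w; rewrite mulr1.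
move: (\int[th]_w _) bp => vbp bp; move: (\int[th]_w _) bn => vbn bn.
move: (\int[th]_w _) cp => vcp cp; move: (\int[th]_w _) cn => vcn cn.
move: (\int[th]_w _) epp => vpp epp; move: (\int[th]_w _) epn => vpn epn.
move: (\int[th]_w _) enp => vnp enp; move: (\int[th]_w _) enn => vnn enn.
have -> : b = vbp - vbn.
  apply: (has_mean_uniq Fb); apply: eq_has_mean (has_meanB bp bn) => // w.
  by rewrite [in RHS](posneg (p w)) mulrBr.
have -> : c = vcp - vcn.
  apply: (has_mean_uniq Fc); apply: eq_has_mean (has_meanB cp cn) => // w.
  by rewrite [in RHS](posneg (q w)) mulrBr.
have -> : e = (vpp - vpn) - (vnp - vnn).
  apply: (has_mean_uniq Fe).
  apply: eq_has_mean (has_meanB (has_meanB epp epn) (has_meanB enp enn)) => // w.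
  rewrite /= [in RHS](posneg (p w)) [in RHS](posneg (q w)).
  move: (pos (p w)) (neg (p w)) (pos (q w)) (neg (q w)) => p1 p2 q1 q2.
  by ring.
have k1 : vbp * vcp <= vpp * a.
  apply: (weighted_four_means F0 FF bp cp epp F1) => // [w|x y].
    by rewrite mulr_ge0.
  rewrite mulr1 /= ler_pM//; apply: posI; [apply: ip|apply: iq];
    [exact: le_row_joinl|exact: le_row_joinr].
have k2 : vbn * vcn <= a * vnn.
  apply: (weighted_four_means F0 FF bn cn F1 enn) => // [w|x y].
    by rewrite mulr_ge0.
  rewrite mul1r ler_pM//; apply: negD; [apply: ip|apply: iq];
    [exact: le_row_meetl|exact: le_row_meetr].
have k3 : vpn * a <= vbp * vcn.
  apply: (weighted_four_means F0 FF epn F1 bp cn) => // [w|x y].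
    by rewrite mulr_ge0.
  rewrite mulr1 /= ler_pM//; [apply: posI; apply: ip|apply: negD; apply: iq];
    [exact: le_row_joinl|exact: le_row_meetl].
have k4 : vnp * a <= vcp * vbn.
  apply: (weighted_four_means F0 FF enp F1 cp bn) => // [w|x y].
    by rewrite mulr_ge0.
  rewrite mulr1 /= mulrC ler_pM//; [apply: posI; apply: iq|apply: negD; apply: ip];
    [exact: le_row_joinl|exact: le_row_meetl].
by move: k1 k2 k3 k4; clear; lra.
Qed.

End fkg.
(** * Covariance of two convex functions of the same variable *)

Section one_dimension.
Context (R : realType).
Variables (P : probability (measurableTypeR R) R).
Implicit Types (f g A : measurableTypeR R -> R).

(** [f] is a convex function of [A], stated by subgradients: this form passes to
    the exponential and gives the sign of [det3] at once. *)
Definition convex_wrt (A f : R -> R) :=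
  forall t, exists c, forall u, f t + c * (A u - A t) <= f u.

(** The determinant of the rows (1, A, f) at the three points [s], [t], [r],
    expanded with respect to the values at [s], the first variable to be
    integrated. *)
Definition det3 (A f : R -> R) (s t r : R) :=
  (A t * f r - A r * f t) + (f t - f r) * A s + (A r - A t) * f s.

Lemma det3_ge0 A f s t r : convex_wrt A f -> A s <= A t -> A t <= A r ->
  0 <= det3 A f s t r.
Proof.
move=> /(_ t)[c cf] st tr; have fs := cf s; have fr := cf r.
have h1 : 0 <= (A r - A t) * (f s - (f t + c * (A s - A t))).
  by rewrite mulr_ge0// subr_ge0.
have h2 : 0 <= (A t - A s) * (f r - (f t + c * (A r - A t))).
  by rewrite mulr_ge0// subr_ge0.
rewrite /det3; apply: le_trans (addr_ge0 h1 h2) _.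
by rewrite le_eqVlt; apply/orP; left; apply/eqP; ring.
Qed.

(** A permutation of the points changes both signs alike. *)
Lemma det3_mul_ge0 A f g s t r : convex_wrt A f -> convex_wrt A g ->
  0 <= det3 A f s t r * det3 A g s t r.
Proof.
move=> Af Ag.
have swap12 h : det3 A h s t r = - det3 A h t s r by rewrite /det3; ring.
have swap23 h : det3 A h s t r = - det3 A h s r t by rewrite /det3; ring.
have rot h : det3 A h s t r = det3 A h t r s by rewrite /det3; ring.
have rot2 h : det3 A h s t r = det3 A h r s t by rewrite /det3; ring.
have swap13 h : det3 A h s t r = - det3 A h r t s by rewrite /det3; ring.
have [st|/ltW ts] := leP (A s) (A t); have [tr|/ltW rt] := leP (A t) (A r);
  have [sr|/ltW rs] := leP (A s) (A r).
- by rewrite mulr_ge0// det3_ge0.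
- by rewrite mulr_ge0// det3_ge0.
- by rewrite !swap23 mulrNN mulr_ge0// det3_ge0.
- by rewrite !rot2 mulr_ge0// det3_ge0.
- by rewrite !swap12 mulrNN mulr_ge0// det3_ge0.
- by rewrite !rot mulr_ge0// det3_ge0.
- by rewrite !swap13 mulrNN mulr_ge0// det3_ge0.
- by rewrite !swap13 mulrNN mulr_ge0// det3_ge0.
Qed.

Lemma convex_wrt_affine A f a b : convex_wrt A f ->
  convex_wrt A (fun t => f t - a - b * A t).
Proof.
move=> Af t; have [c cf] := Af t; exists (c - b) => u.
by have := cf u; lra.
Qed.

Section orthogonal.
Variables (A f g : measurableTypeR R -> R) (V C : R).
Hypotheses (Af : convex_wrt A f) (Ag : convex_wrt A g).
Hypotheses (A0 : has_mean P A 0) (f0 : has_mean P f 0) (g0 : has_mean P g 0).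
Hypotheses (AA : has_mean P (fun t => A t * A t) V)
  (fg : has_mean P (fun t => f t * g t) C)
  (Af0 : has_mean P (fun t => A t * f t) 0)
  (Ag0 : has_mean P (fun t => A t * g t) 0).

(** By the Andreief identity, the mean over three independent points of
    [det3 A f * det3 A g] is 6 times the Gram determinant of (1, A, f) against
    (1, A, g).  Here this Gram matrix is diagonal, with entries 1, [V], [C].
    The steps integrate the first, the second and the third point in turn. *)
Lemma orthogonal_convex_mean_ge0 : 0 <= V * C.
Proof.
have step1 t r : 0 <= (A t * f r - A r * f t) * (A t * g r - A r * g t)
    + (f t - f r) * (g t - g r) * V + (A r - A t) * (A r - A t) * C.
  pose al h := A t * h r - A r * h t; pose be h := h t - h r : R.
  pose ga := A r - A t.
  have := has_meanD (has_mean_cst P (al f * al g)) (has_meanD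
    (has_meanD (has_meanZ (be f * be g) AA) (has_meanZ (ga * ga) fg))
    (has_meanD (has_meanZ (al f * be g + be f * al g) A0) (has_meanD
      (has_meanD (has_meanZ (al f * ga) g0) (has_meanZ (al g * ga) f0))
      (has_meanD (has_meanZ (be f * ga) Ag0) (has_meanZ (be g * ga) Af0))))).
  move=> /has_mean_ge0 H; apply: le_trans (H _) _.
    apply: nearW => s; apply: le_trans (det3_mul_ge0 s t r Af Ag) _.
    by rewrite le_eqVlt; apply/orP; left; apply/eqP; rewrite /det3/al/be/ga; ring.
  by rewrite le_eqVlt; apply/orP; left; apply/eqP; rewrite /al/be/ga; ring.
have step2 r : 0 <= V * (f r * g r) + C * (A r * A r)
    + V * (C + f r * g r) + (V + A r * A r) * C.
  have := has_meanD
   (has_meanD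
    (has_meanD (has_meanZ (f r * g r) AA) (has_meanZ (A r * A r) fg))
    (has_meanD (has_meanZ (- (A r * f r)) Ag0) (has_meanZ (- (A r * g r)) Af0)))
   (has_meanD
    (has_meanD (has_meanD (has_meanZ V fg) (has_mean_cst P (V * (f r * g r))))
      (has_meanD (has_meanZ (- V * f r) g0) (has_meanZ (- V * g r) f0)))
    (has_meanD (has_meanD (has_meanZ C AA) (has_mean_cst P (C * (A r * A r))))
      (has_meanZ (- (2 * C * A r)) A0))).
  move=> /has_mean_ge0 H; apply: le_trans (H _) _.
    apply: nearW => t; apply: le_trans (step1 t r) _.
    by rewrite le_eqVlt; apply/orP; left; apply/eqP; ring.
  by rewrite le_eqVlt; apply/orP; left; apply/eqP; ring.
have := has_meanD (has_meanZ (2 * V) fg)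
  (has_meanD (has_meanZ (2 * C) AA) (has_mean_cst P (2 * V * C))).
move=> /has_mean_ge0 H.
rewrite -(@pmulr_rge0 _ 6)//; apply: le_trans (H _) _.
  apply: nearW => r; apply: le_trans (step2 r) _.
  by rewrite le_eqVlt; apply/orP; left; apply/eqP; ring.
by rewrite le_eqVlt; apply/orP; left; apply/eqP; ring.
Qed.

(** If [V = 0] then [A] vanishes almost everywhere, and a convex function of
    [A] is constant where [A] is. *)
Lemma orthogonal_convex_mean0 : V = 0 -> C = 0.
Proof.
move=> V0; move: AA; rewrite V0 => /has_mean_eq0 -/(_ (fun t => _)) A_eq0.
have {}A_eq0 : \forall t \ae P, A t = 0.
  apply: filterS (A_eq0 _) => [t /eqP|t]; last exact: sqr_ge0.
  by rewrite mulf_eq0 orbb => /eqP.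
have fE t u : A t = 0 -> A u = 0 -> f t = f u.
  move=> At Au; have [c /(_ u)] := Af t; have [c' /(_ t)] := Af u.
  by rewrite At Au subrr !mulr0 !addr0 => h1 h2; apply/eqP; rewrite eq_le h1 h2.
have [[t0 At0]|noA] := pselect (exists t, A t = 0); last first.
  have : \forall t \ae P, False.
    by apply: filterS A_eq0 => t At; apply: noA; exists t.
  move=> noP; apply: (has_mean_uniq fg).
  apply: ae_eq_has_mean (has_mean_cst P 0); first exact: has_mean_measurable fg.
  by apply: filterS noP.
have fc : \forall t \ae P, f t0 * g t = f t * g t.
  by apply: filterS A_eq0 => t At; rewrite (fE t0 t).
have := ae_eq_has_mean (has_mean_measurable fg) fc (has_meanZ (f t0) g0).
by rewrite mulr0 => /(has_mean_uniq fg).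
Qed.

End orthogonal.

(** The residuals of [f] and [g] after projection on 1 and [A] are still convex
    functions of [A], and the difference of the two sides is their correlation.
    If [V = 0], then [V^-1 = 0] and the covariance vanishes. *)
Lemma covariance_convex_wrt A f g V a b c u v :
  convex_wrt A f -> convex_wrt A g ->
  has_mean P A 0 -> has_mean P (fun t => A t * A t) V ->
  has_mean P f a -> has_mean P g b -> has_mean P (fun t => f t * g t) c ->
  has_mean P (fun t => A t * f t) u -> has_mean P (fun t => A t * g t) v ->
  V^-1 * (u * v) <= c - a * b.
Proof.
move=> cf cg A0 AA fa gb fg Af Ag.
have f0 x : has_mean P (fun t => f t - a - x * A t) 0.
  have := has_meanB (has_meanB fa (has_mean_cst P a)) (has_meanZ x A0).
  by apply: eq_has_mean => //; ring.
have g0 x : has_mean P (fun t => g t - b - x * A t) 0.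
  have := has_meanB (has_meanB gb (has_mean_cst P b)) (has_meanZ x A0).
  by apply: eq_has_mean => //; ring.
have fg0 x y : has_mean P
    (fun t => (f t - a - x * A t) * (g t - b - y * A t))
    (c - a * b - y * u - x * v + x * y * V).
  have := has_meanD (has_meanB (has_meanB fg (has_meanZ y Af))
    (has_meanZ x Ag)) (has_meanD (has_meanZ (x * y) AA)
     (has_meanD (has_meanZ (a * y + b * x) A0)
     (has_meanB (has_mean_cst P (a * b)) (has_meanD (has_meanZ a gb) (has_meanZ b fa))))).
  by apply: eq_has_mean => [t|]; ring.
have [V0|V_neq0] := eqVneq V 0.
  have := orthogonal_convex_mean0 (convex_wrt_affine a 0 cf) (g0 0) AA (fg0 0 0) V0.
  by rewrite V0 invr0 !mul0r; lra.
have V_gt0 : 0 < V.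
  rewrite lt_def V_neq0; apply: has_mean_ge0 AA.
  by apply: nearW => t; exact: sqr_ge0.
have Af0 : has_mean P (fun t => A t * (f t - a - V^-1 * u * A t)) 0.
  have := has_meanB (has_meanB Af (has_meanZ a A0)) (has_meanZ (V^-1 * u) AA).
  by apply: eq_has_mean => [t|]; [ring|field].
have Ag0 : has_mean P (fun t => A t * (g t - b - V^-1 * v * A t)) 0.
  have := has_meanB (has_meanB Ag (has_meanZ b A0)) (has_meanZ (V^-1 * v) AA).
  by apply: eq_has_mean => [t|]; [ring|field].
have := orthogonal_convex_mean_ge0 (convex_wrt_affine a _ cf)
  (convex_wrt_affine b _ cg) A0 (f0 _) (g0 _) AA (fg0 _ _) Af0 Ag0.
rewrite pmulr_rge0// => h; rewrite -subr_ge0; apply: le_trans h _.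
by rewrite le_eqVlt; apply/orP; left; apply/eqP; field.
Qed.
End one_dimension.
(** * From signs of derivatives to convexity and supermodularity *)

Section calculus_line.
Context (R : realType).
Implicit Types (F A a W : R -> R).

Lemma is_derive_line (V : normedModType R) (h : V -> R) (x v : V) (t dh : R) :
  is_derive (x + t *: v) v h dh <->
  is_derive t (1 : R) (fun s : R => h (x + s *: v)) dh.
Proof.
have E : (fun k : R => k^-1 *: ((h \o shift (x + t *: v)) (k *: v)
      - h (x + t *: v))) =
    (fun k : R => k^-1 *: (((fun s : R => h (x + s *: v)) \o shift t) (k *: 1)
      - h (x + t *: v))).
  apply/funext => k /=; congr (_ *: (h _ - _)).
  by rewrite [k *: 1]mulr1 scalerDl addrCA.
by split=> -[dh1 dh2]; split; move: dh1 dh2; rewrite /derivable /derive E.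
Qed.

Lemma derivable_continuous_segment F dF (u v : R) :
  (forall t, is_derive t (1 : R) F (dF t)) -> {within `[u, v], continuous F}.
Proof.
by move=> FdF; apply: derivable_within_continuous => t _; case: (FdF t).
Qed.

Lemma is_derive_ge0_le F (dF : R -> R) (u v : R) :
  (forall t, is_derive t (1 : R) F (dF t)) ->
  (forall t, u <= t -> t <= v -> 0 <= dF t) -> u <= v -> F u <= F v.
Proof.
move=> FdF dF0 uv.
have [|c + Fuv] := @MVT_segment R F dF u v uv (fun t _ => FdF t).
  exact: derivable_continuous_segment FdF.
rewrite in_itv/= => /andP[uc cv].
by rewrite -subr_ge0 Fuv mulr_ge0 ?subr_ge0// dF0.
Qed.

(** The subgradient at [t] is [W t = F' t / A' t]: the function
    [F - W t * A] has derivative [(W - W t) * a], so it is minimal at [t]. *)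
Lemma convex_wrt_of_derive F A a W :
  (forall t, is_derive t (1 : R) F (W t * a t)) ->
  (forall t, is_derive t (1 : R) A (a t)) ->
  (forall t, 0 < a t) -> {homo W : s t / s <= t} ->
  convex_wrt A F.
Proof.
move=> FW Aa a0 W_nd t; exists (W t) => u.
pose G := F - W t *: A.
have Gd s : is_derive s (1 : R) G ((W s - W t) * a s).
  by rewrite mulrBl; apply: is_deriveB; apply: is_deriveZ.
have GE s : G s = F s - W t * A s by [].
have [tu|/ltW ut] := leP t u.
  have := @is_derive_ge0_le G _ t u Gd; rewrite !GE => H.
  suff : F t - W t * A t <= F u - W t * A u by lra.
  apply: H => // s ts _; apply: mulr_ge0; last exact: ltW.
  by rewrite subr_ge0 W_nd.
have := @is_derive_ge0_le (- G) _ u t (fun s => is_deriveN (Gd s)).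
rewrite -[(- G) u]/(- G u) -[(- G) t]/(- G t) !GE => H.
suff : - (F u - W t * A u) <= - (F t - W t * A t) by lra.
apply: H => // s _ st; rewrite -mulNr opprB; apply: mulr_ge0; last exact: ltW.
by rewrite subr_ge0 W_nd.
Qed.

(** The tangent line of [expR] at [F t] composed with the subgradient of [F]. *)
Lemma convex_wrt_expR A F : convex_wrt A F -> convex_wrt A (expR \o F).
Proof.
move=> AF t; have [c cF] := AF t; exists (expR (F t) * c) => u /=.
have := expR_ge1Dx (F u - F t); rewrite expRD expRN => h.
have e0 := expR_gt0 (F t); have := cF u => h2.
have -> : expR (F u) = expR (F t) * (expR (F u) / expR (F t)).
  by rewrite mulrCA divff ?mulr1// gt_eqF.
rewrite -mulrA -[X in X + _]mulr1 -mulrDr ler_pM2l//.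
by apply: le_trans h; lra.
Qed.

End calculus_line.

Section partial_derivatives.
Context (R : realType) (d : nat).
Implicit Types (h f phi : 'rV[R]_d -> R) (x y p q : 'rV[R]_d) (i j : 'I_d).
Local Notation e := (unit_vec R).

Definition has_pderiv i h := forall x, derivable h x (e i).

Lemma is_derive_pderiv i h x : has_pderiv i h ->
  forall t, is_derive t (1 : R) (fun s : R => h (x + s *: e i))
    (pderiv i h (x + t *: e i)).
Proof.
move=> hi t; apply: (iffLR (is_derive_line h x (e i) t _)).
exact: (DeriveDef (hi _) erefl).
Qed.

Lemma pderiv_ge0_le i h x (s t : R) : has_pderiv i h ->
  (forall y, 0 <= pderiv i h y) -> s <= t ->
  h (x + s *: e i) <= h (x + t *: e i).
Proof.
move=> hi h0 st.
exact: (is_derive_ge0_le (is_derive_pderiv x hi) (fun _ _ _ => h0 _) st).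
Qed.

Definition pairwise_supermodular h := forall i j x (s t : R), i != j ->
  0 <= s -> 0 <= t ->
  h (x + s *: e i) + h (x + t *: e j) <= h (x + s *: e i + t *: e j) + h x.

Lemma pderiv2_pairwise_supermodular h :
  (forall i, has_pderiv i h) ->
  (forall i j, i != j -> has_pderiv i (pderiv j h)) ->
  (forall i j x, i != j -> 0 <= pderiv i (pderiv j h) x) ->
  pairwise_supermodular h.
Proof.
move=> h1 h2 h20 i j x s t ij s0 t0.
pose D (r : R) := h (x + s *: e i + r *: e j) - h (x + r *: e j).
suff : D 0 <= D t by rewrite /D !scale0r !addr0; lra.
apply: (@is_derive_ge0_le _ D (fun r => pderiv j h (x + s *: e i + r *: e j) -
  pderiv j h (x + r *: e j)) 0 t _ _ t0) => [r|r _ _].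
  by apply: is_deriveB; exact: is_derive_pderiv.
rewrite subr_ge0 addrAC.
have := @pderiv_ge0_le i (pderiv j h) (x + r *: e j) 0 s (h2 _ _ ij)
  (fun y => h20 _ _ y ij) s0.
by rewrite scale0r addr0.
Qed.

Lemma le_add_coords (D : 'rV[R]_d -> R) p :
  (forall i x, D x <= D (x + p ord0 i *: e i)) -> forall x, D x <= D (x + p).
Proof.
move=> Dp x; rewrite [p in leRHS]row_sum_delta.
elim: (index_enum _) x => [|i l IH] x; first by rewrite big_nil addr0.
rewrite big_cons addrA; exact: le_trans (Dp i x) (IH _).
Qed.

Definition supermodular h := forall x y, h x + h y <= h (joinv x y) + h (meetv x y).

(** Write [x = m + p] and [y = m + q], where [m] is the meet and [p], [q] have
    disjoint supports.  Adding [q] one coordinate at a time can only increase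
    the increment of [h] along one coordinate of [p]; then adding [p] one
    coordinate at a time can only increase the increment of [h] along [q].
    Arguing by coordinates avoids derivatives of [h] in the directions [p] and
    [q], which partial derivatives alone do not provide. *)
Lemma pairwise_supermodularP h : pairwise_supermodular h -> supermodular h.
Proof.
move=> hh x y; set m := meetv x y; pose p := x - m; pose q := y - m.
have xE : x = m + p by rewrite addrC subrK.
have yE : y = m + q by rewrite addrC subrK.
have jE : joinv x y = m + p + q.
  apply/rowP => i; rewrite /p /q !mxE /Num.max /Num.min.
  by case: ifP => _; ring.
have p0 i : 0 <= p ord0 i by rewrite !mxE subr_ge0 ge_min lexx.
have q0 i : 0 <= q ord0 i by rewrite !mxE subr_ge0 ge_min lexx orbT.
have pq0 i : p ord0 i = 0 \/ q ord0 i = 0.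
  rewrite !mxE; case: leP => _; rewrite subrr; by [left|right].
have Dq i z : h (z + p ord0 i *: e i) - h z <=
    h (z + q + p ord0 i *: e i) - h (z + q).
  apply: (@le_add_coords (fun z => h (z + p ord0 i *: e i) - h z)) => j {}z.
  have [<-|ij] := eqVneq i j.
    by case: (pq0 i) => ->; rewrite !scale0r !addr0 ?subrr.
  have := hh i j z _ _ ij (p0 i) (q0 j).
  by rewrite (addrAC z (q ord0 j *: _)); lra.
have : h (m + q) - h m <= h (m + p + q) - h (m + p).
  apply: (@le_add_coords (fun z => h (z + q) - h z)) => i z.
  by have := Dq i z; rewrite (addrAC z q); lra.
by rewrite -jE -xE -yE; lra.
Qed.

Lemma supermodular_of_pderiv2 h :
  (forall i, has_pderiv i h) ->
  (forall i j, i != j -> has_pderiv i (pderiv j h)) ->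
  (forall i j x, i != j -> 0 <= pderiv i (pderiv j h) x) ->
  supermodular h.
Proof. by move=> *; exact/pairwise_supermodularP/pderiv2_pairwise_supermodular. Qed.

Lemma updE i (s : R) x : upd i s x = upd i 0 x + s *: e i.
Proof.
apply/rowP => j; rewrite !mxE eqxx/=.
by case: eqP => _; rewrite ?mulr1 ?mulr0 ?add0r ?addr0.
Qed.

Lemma convex_wrt_of_weighted_pderiv (a A : 'I_d -> R -> R) i h :
  (forall t, 0 < a i t) -> (forall t : R, is_derive t (1 : R) (A i) (a i t)) ->
  has_pderiv i h -> has_pderiv i (weighted_pderiv a i h) ->
  (forall x, 0 <= pderiv i (weighted_pderiv a i h) x) ->
  forall x, convex_wrt (A i) (fun s => h (upd i s x)).
Proof.
move=> a0 Aa h1 h2 h20 x; pose x0 := upd i 0 x.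
rewrite (_ : (fun s => _) = (fun s => h (x0 + s *: e i))); last first.
  by apply/funext => s; rewrite updE.
pose W (s : R) := weighted_pderiv a i h (x0 + s *: e i).
have FW (t : R) : is_derive t (1 : R) (fun s : R => h (x0 + s *: e i))
    (W t * a i t).
  have -> : W t * a i t = pderiv i h (x0 + t *: e i).
    by rewrite /W /weighted_pderiv {2}/x0 -updE mxE eqxx divfK ?gt_eqF.
  exact: (is_derive_pderiv x0 h1).
exact: (convex_wrt_of_derive FW Aa a0
  (fun s t st => pderiv_ge0_le x0 h2 h20 st)).
Qed.

Lemma pderivN i h : has_pderiv i h -> pderiv i (- h) = - pderiv i h.
Proof. by move=> hi; apply/funext => x; exact: deriveN. Qed.

Lemma weighted_pderivN a i h : has_pderiv i h ->
  weighted_pderiv a i (- h) = - weighted_pderiv a i h.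
Proof.
by move=> hi; apply/funext => x; rewrite /weighted_pderiv pderivN// mulNr.
Qed.

Lemma has_pderivN i h : has_pderiv i h -> has_pderiv i (- h).
Proof. by move=> hi x; exact: derivableN. Qed.

Section exponential.
Variables (f phi : 'rV[R]_d -> R).
Hypothesis fE : forall x, f x = expR (- phi x).

Lemma exponent_is_derive x v (df : R) : is_derive x v f df ->
  is_derive x v phi (- (df / f x)).
Proof.
have f0 y : 0 < f y by rewrite fE expR_gt0.
have phiE y : phi y = - ln (f y) by rewrite fE expRK opprK.
move=> fd; have [+ _] := is_derive_line f x v 0 df.
rewrite scale0r addr0 => /(_ fd) => fl.
have [_] := is_derive_line phi x v 0 (- (df / f x)).
rewrite scale0r addr0; apply.
rewrite (_ : (fun s => _) = - ((@ln R) \o (fun s : R => f (x + s *: v)))); last first.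
  by apply/funext => s; rewrite phiE.
apply: is_deriveN; rewrite mulrC; apply: is_derive1_comp.
have := is_derive1_ln (f0 x); by rewrite -{1}[x]addr0 -(scale0r v).
Qed.

Lemma exponent_pderiv i : has_pderiv i f -> has_pderiv i phi /\
  pderiv i phi = fun x => - (pderiv i f x / f x).
Proof.
move=> fi; have H x := exponent_is_derive (DeriveDef (fi x) erefl).
by split=> [x|]; [case: (H x)|apply/funext => x; case: (H x)].
Qed.

Lemma exponent_pderiv2 i j : has_pderiv i f -> has_pderiv j f ->
  has_pderiv i (pderiv j f) -> has_pderiv i (pderiv j phi).
Proof.
move=> fi fj fij x; rewrite (exponent_pderiv fj).2.
apply: (@derivableN _ _ _ (fun y => pderiv j f y / f y)).
apply: derivableM; first exact: fij.
by apply: derivableV; [rewrite fE gt_eqF ?expR_gt0|exact: fi].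
Qed.

Lemma exponent_log_supermodular :
  (forall i, has_pderiv i f) -> (forall i j, has_pderiv i (pderiv j f)) ->
  (forall x i j, i != j -> pderiv i (pderiv j phi) x <= 0) ->
  log_supermodular f.
Proof.
move=> f1 f2 phi2 x y.
have p1 i := (exponent_pderiv (f1 i)).1.
have p2 i j : has_pderiv i (pderiv j phi) by exact: exponent_pderiv2.
have : supermodular (- phi).
  apply: supermodular_of_pderiv2 => [i|i j ij|i j z ij].
  - exact: has_pderivN.
  - by rewrite pderivN//; exact: has_pderivN.
  - rewrite pderivN// pderivN// -[(- _) z]/(- pderiv i (pderiv j phi) z).
    by rewrite oppr_ge0 phi2.
by move=> /(_ x y); rewrite !fE -!expRD ler_expR.
Qed.

Lemma exponent_convex_wrt (a A : 'I_d -> R -> R) i :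
  (forall t, 0 < a i t) -> (forall t : R, is_derive t (1 : R) (A i) (a i t)) ->
  has_pderiv i f -> has_pderiv i (weighted_pderiv a i phi) ->
  (forall x, pderiv i (weighted_pderiv a i phi) x <= 0) ->
  forall x, convex_wrt (A i) (fun s => f (upd i s x)).
Proof.
move=> a0 Aa f1 phi1 phi2 x; have p1 := (exponent_pderiv f1).1.
rewrite (_ : (fun s => _) = expR \o (fun s => (- phi) (upd i s x))); last first.
  by apply/funext => s; rewrite fE.
have q1 : has_pderiv i (weighted_pderiv a i (- phi)).
  rewrite (weighted_pderivN a p1); exact: (has_pderivN phi1).
have q2 y : 0 <= pderiv i (weighted_pderiv a i (- phi)) y.
  rewrite (weighted_pderivN a p1) (pderivN phi1).
  by rewrite -[(- _) y]/(- pderiv i (weighted_pderiv a i phi) y) oppr_ge0.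
apply: convex_wrt_expR.
exact: (convex_wrt_of_weighted_pderiv a0 Aa (has_pderivN p1) q1 q2).
Qed.

End exponential.

End partial_derivatives.
(** * Integrating one coordinate of a product *)

Section coordinate_means.
Context (R : realType) (n : nat).
Variables (nu : 'I_n -> probability (measurableTypeR R) R).
Variables (th : probability 'rV[R]_n R).
Hypothesis thP : is_product_measure nu th.
Implicit Types (u v h : 'rV[R]_n -> R) (i : 'I_n).

Definition coord_mean i h : 'rV[R]_n -> R :=
  fun w => \int[nu i]_s h (upd i s w).

Lemma has_mean_coord_mean i h m : has_mean th h m ->
  (\forall w \ae th, (nu i).-integrable setT (EFin \o (fun s => h (upd i s w))))
  /\ has_mean th (coord_mean i h) m.
Proof.
by move=> /(preserving_has_mean (preserving_upd thP i))/has_mean_fubini.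
Qed.

Lemma sq_integrable_section i h : sq_integrable th h ->
  \forall w \ae th, sq_integrable (nu i) (fun s => h (upd i s w)).
Proof.
move=> [mh hi]; have [+ _] := has_mean_coord_mean i (has_mean_int hi).
apply: filterS => w hw; split=> //.
by apply: measurableT_comp => //; exact: measurable_upd_scalar.
Qed.

Lemma has_mean_coord_mean_mul i u v a m :
  has_mean th u a -> measurable_fun setT v -> free_of v i ->
  has_mean th (fun w => u w * v w) m ->
  has_mean th (fun w => coord_mean i u w * v w) m.
Proof.
move=> ua mv vi uv.
have [ui umean] := has_mean_coord_mean i ua.
have [_ uvmean] := has_mean_coord_mean i uv.
apply: ae_eq_has_mean uvmean.
  by apply: measurable_funM => //; exact: has_mean_measurable umean.
apply: filterS ui => w uw; rewrite /coord_mean -RintegralZr//.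
by apply: eq_Rintegral => s _; rewrite vi.
Qed.

Lemma free_of_coord_mean i j h : free_of h j -> free_of (coord_mean i h) j.
Proof.
move=> hj s w; rewrite /coord_mean; apply: eq_Rintegral => t _.
by have [->|ij] := eqVneq i j; [rewrite updK|rewrite updC].
Qed.

(** If [u] does not see coordinate [j] and [v] does not see coordinate [i], then
    the means in these two coordinates can be taken on each factor separately. *)
Lemma has_mean_mul_coord_mean i j u v a b m :
  has_mean th u a -> has_mean th v b -> free_of u j -> free_of v i ->
  has_mean th (fun w => u w * v w) m ->
  has_mean th (fun w => coord_mean i u w * coord_mean j v w) m.
Proof.
move=> ua vb uj vi uv.
have h1 := has_mean_coord_mean_mul ua (has_mean_measurable vb) vi uv.
have [_ umean] := has_mean_coord_mean i ua.
have := has_mean_coord_mean_mul vb (has_mean_measurable umean)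
  (free_of_coord_mean i uj) (eq_has_mean (fun w => mulrC _ _) erefl h1).
by apply: eq_has_mean => // w; rewrite mulrC.
Qed.

Lemma mean0_mul_free i (b : R -> R) v m :
  has_mean (nu i) b 0 -> measurable_fun setT v -> free_of v i ->
  has_mean th (fun w => b (w ord0 i) * v w) m -> m = 0.
Proof.
move=> b0 mv vi bv.
have := has_mean_coord_mean_mul
  (preserving_has_mean (preserving_coord thP i) b0) mv vi bv.
have E w : coord_mean i (fun w => b (w ord0 i)) w = 0.
  rewrite /coord_mean -[RHS]b0.2; apply: eq_Rintegral => s _.
  by rewrite mxE eqxx.
move=> /(eq_has_mean (g := fun=> 0) _ erefl) H.
apply: has_mean_uniq (H _) (has_mean_cst th 0) => w.
by rewrite E mul0r.
Qed.

(** By independence the second moment of the product is the product of the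
    second moments. *)
Lemma sq_integrable_mul_free i h (b : measurableTypeR R -> R) :
  sq_integrable th h -> sq_integrable (nu i) b -> free_of h i ->
  sq_integrable th (fun w => h w * b (w ord0 i)).
Proof.
move=> [mh hi] [mb bi] hfree.
have mbi : measurable_fun setT (fun w : 'rV[R]_n => b (w ord0 i)).
  by apply: measurableT_comp => //; exact: measurable_coord.
have mhb : measurable_fun setT (fun w => h w * b (w ord0 i)).
  exact: measurable_funM.
split=> //; apply/integrableP; split.
  by apply/measurable_EFinP; exact: measurable_funX.
pose k w := ((h w * b (w ord0 i)) ^+ 2)%:E.
have mk : measurable_fun setT k.
  by apply/measurable_EFinP; exact: measurable_funX.
have k0 w : (0 <= k w)%E by rewrite lee_fin sqr_ge0.
rewrite (eq_integral k) => [|w _]; last by rewrite gee0_abs.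
rewrite (integral_integrate_coord thP i mk k0).
have kE w : integrate_coord nu i k w =
    ((h w ^+ 2)%:E * \int[nu i]_s (b s ^+ 2)%:E)%E.
  rewrite -ge0_integralZl//.
  - apply: eq_integral => s _; rewrite /k hfree mxE eqxx exprMn EFinM //.
  - by apply/measurable_EFinP; exact: measurable_funX.
  - by move=> s _; rewrite lee_fin sqr_ge0.
  - by rewrite lee_fin sqr_ge0.
under eq_integral do rewrite kE.
have B0 : (0 <= \int[nu i]_s (b s ^+ 2)%:E)%E.
  by apply: integral_ge0 => s _; rewrite lee_fin sqr_ge0.
rewrite ge0_integralZr//.
- rewrite -[X in (_ * X)%E]fineK; last exact: integrable_fin_num.
  rewrite -[X in (X * _)%E]fineK; last exact: integrable_fin_num.
  by rewrite -EFinM ltry.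
- by apply/measurable_EFinP; exact: measurable_funX.
- by move=> w _; rewrite lee_fin sqr_ge0.
Qed.

End coordinate_means.

Lemma has_mean_gt0 d (T : measurableType d) (R : realType)
  (P : probability T R) (f : T -> R) u :
  (forall x, 0 < f x) -> has_mean P f u -> 0 < u.
Proof.
move=> f0 fu; rewrite lt_def (has_mean_ge0 _ fu) ?andbT; last first.
  by apply: nearW => x; exact: ltW.
apply/eqP => u0; move: fu; rewrite u0 => /has_mean_eq0 H.
have {}H : \forall x \ae P, (1 : R) = 0.
  by apply: filterS (H (fun x => ltW (f0 x))) => x fx; have := f0 x; rewrite fx ltxx.
have := ae_eq_has_mean (g := fun=> 0) (measurable_cst _) H (has_mean_cst P 1).
by move=> /(has_mean_uniq (has_mean_cst P 0)) /eqP; rewrite eq_sym oner_eq0.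
Qed.

Lemma covariance_has_mean d (T : measurableType d) (R : realType)
  (P : probability T R) (f g : T -> R) a b c :
  has_mean P f a -> has_mean P g b -> has_mean P (fun x => f x * g x) c ->
  covariance P f g = (c - a * b)%:E.
Proof.
move=> fa gb fg.
have [h hc] : has_mean P (fun x => (f x - a) * (g x - b)) (c - a * b).
  have := has_meanD fg (has_meanB (has_mean_cst P (a * b))
    (has_meanD (has_meanZ b fa) (has_meanZ a gb))).
  by apply: eq_has_mean => [x|]; ring.
have E k : fine 'E_P[k] = \int[P]_x k x by rewrite unlock.
rewrite unlock !E fa.2 gb.2 -hc unlock /Rintegral fineK//.
exact: integrable_fin_num.
Qed.
(** * Three independent copies of the measure *)

Section copies.
Context (R : realType) (d n : nat).
Variables (muk : 'I_d -> probability (measurableTypeR R) R).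
Variables (mu : probability 'rV[R]_d R).
Hypothesis muP : is_product_measure muk mu.
(* [copy c i] is the coordinate of the large vector that carries coordinate [i]
   of the copy with colour [c]: X, Y, and a third one, T. *)
Variables (copy : option bool -> 'I_d -> 'I_n).
Hypothesis copy_inj : forall c c' i i', copy c i = copy c' i' -> c = c' /\ i = i'.
Variables (nu : 'I_n -> probability (measurableTypeR R) R).
Variables (th : probability 'rV[R]_n R).
Hypothesis thP : is_product_measure nu th.
Hypothesis nu_copy : forall c i, nu (copy c i) = muk i.
Implicit Types (w : 'rV[R]_n) (col : 'I_d -> option bool) (i k : 'I_d).

Local Notation cX := (Some true).
Local Notation cY := (Some false).
Local Notation cT := None.

(** The vector whose coordinate [i] is taken from the copy [col i].  It has law
    [mu] for every colouring, because no coordinate is used twice. *)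
Definition pick_row col : 'rV[R]_n -> 'rV[R]_d :=
  reindex_row (fun i => copy (col i) i).

Lemma copy_eq c c' i i' : (copy c i == copy c' i') = (c == c') && (i == i').
Proof.
by apply/eqP/andP => [/copy_inj[-> ->]|[/eqP-> /eqP->]].
Qed.

Lemma preserving_pick_row col : preserving th mu (pick_row col).
Proof.
apply: (preserving_reindex _ thP) => [i j /copy_inj[_]//|].
by have -> : nu \o (fun i => copy (col i) i) = muk by apply/funext => i /=.
Qed.

Lemma pick_row_upd col c k (s : R) w :
  pick_row col (upd (copy c k) s w) =
  if col k == c then upd k s (pick_row col w) else pick_row col w.
Proof.
apply/rowP => i; rewrite mxE mxE copy_eq.
case: (eqVneq (col k) c) => [<-|kc]; rewrite !mxE.
  by have [->|] := eqVneq i k; rewrite ?eqxx ?andbF.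
by have [->|] := eqVneq i k; rewrite ?andbF // (negbTE kc).
Qed.

Lemma pick_row_free col c k : col k != c -> free_of (pick_row col) (copy c k).
Proof. by move=> kc s w; rewrite pick_row_upd (negbTE kc). Qed.

Lemma pick_row_join col x y :
  pick_row col (joinv x y) = joinv (pick_row col x) (pick_row col y).
Proof. by apply/rowP => i; rewrite !mxE. Qed.

Lemma pick_row_meet col x y :
  pick_row col (meetv x y) = meetv (pick_row col x) (pick_row col y).
Proof. by apply/rowP => i; rewrite !mxE. Qed.

Definition colX : 'I_d -> option bool := fun=> cX.
Definition colXY (m : nat) : 'I_d -> option bool :=
  fun i => if (i < m)%N then cY else cX.
Definition colXYT k : 'I_d -> option bool :=
  fun i => if (i < k)%N then cY else if i == k then cT else cX.

Lemma pick_row_XY_succ k (t : R) w :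
  upd k t (pick_row (colXY k.+1) w) = upd k t (pick_row (colXY k) w).
Proof.
apply/rowP => i; rewrite !mxE; case: eqP => // ik.
rewrite /colXY ltnS leq_eqVlt; case: eqP => // /val_inj /eqP.
by rewrite (introF eqP ik).
Qed.

Variables (A : 'I_d -> R -> R) (f g : 'rV[R]_d -> R).
Hypothesis A2 : forall k, sq_integrable (muk k) (A k).
Hypothesis A0 : forall k, has_mean (muk k) (A k) 0.
Hypothesis f2 : sq_integrable mu f.
Hypothesis g2 : sq_integrable mu g.

(* In the notation of the introduction, [Xf] is f(X), [Zg m] is g(Z_m), and
   [Ak c k] is A_k at coordinate [k] of the copy [c]. *)
Definition Xf w := f (pick_row colX w).
Definition Zg m w := g (pick_row (colXY m) w).
Definition Ak c k w := A k (w ord0 (copy c k)).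

Lemma sq_pick h col : sq_integrable mu h ->
  sq_integrable th (fun w => h (pick_row col w)).
Proof.
move=> hi; exact: (preserving_sq_integrable (preserving_pick_row col) hi).
Qed.

Lemma sq_Xf : sq_integrable th Xf. Proof. exact: sq_pick. Qed.

Lemma sq_Zg m : sq_integrable th (Zg m). Proof. exact: sq_pick. Qed.

Lemma sq_mulA h col c k : sq_integrable mu h -> col k != c ->
  sq_integrable th (fun w => h (pick_row col w) * Ak c k w).
Proof.
move=> h2 kc; apply: (sq_integrable_mul_free thP (sq_pick _ h2)).
  by rewrite nu_copy; exact: A2.
by move=> s w; rewrite pick_row_free.
Qed.

Lemma sq_A c k : sq_integrable th (Ak c k).
Proof.
have H : sq_integrable (nu (copy c k)) (A k) by rewrite nu_copy.
exact: (preserving_sq_integrable (preserving_coord thP (copy c k)) H).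
Qed.

Definition interpolated_mean m := \int[th]_w (Xf w * Zg m w).
Definition cross_moment k :=
  \int[th]_w ((Xf w * Ak cX k w) * (Zg k.+1 w * Ak cY k w)).

Lemma has_mean_interpolated m :
  has_mean th (fun w => Xf w * Zg m w) (interpolated_mean m).
Proof. exact/has_mean_int/(sq_integrableM sq_Xf (sq_Zg m)). Qed.

Lemma colXY_succ k : colXY k.+1 k = cY. Proof. by rewrite /colXY ltnSn. Qed.
Lemma colXY_k k : colXY k k = cX. Proof. by rewrite /colXY ltnn. Qed.

Lemma has_mean_cross k :
  has_mean th (fun w => (Xf w * Ak cX k w) * (Zg k.+1 w * Ak cY k w))
    (cross_moment k).
Proof.
apply: has_mean_int.
have h1 := sq_mulA (col := colX) (c := cY) (k := k) f2 isT.
have h2 := sq_mulA (col := colXY k.+1) (c := cX) (k := k) g2.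
rewrite colXY_succ in h2.
have := sq_integrableM h1 (h2 isT); apply: eq_integrable => // w _ /=.
by congr EFin; rewrite /Xf/Zg; ring.
Qed.

Hypothesis f_convex : forall k x, convex_wrt (A k) (fun s => f (upd k s x)).
Hypothesis g_convex : forall k x, convex_wrt (A k) (fun s => g (upd k s x)).

(** Conditionally on the other coordinates, redraw coordinate [k] of X and of Y.
    Then [interpolated_mean k] is the mean of a product of two slices,
    [interpolated_mean k.+1] the mean of the product of their means, and the
    cross moment the mean of the product of their moments against [A k], so
    that the one-variable inequality applies to almost every pair of slices. *)
Lemma interpolated_mean_step k :
  (\int[muk k]_t (A k t * A k t))^-1 * cross_moment k <=
  interpolated_mean k - interpolated_mean k.+1.
Proof.
set V := Rintegral _ _ _.
have hV : has_mean (muk k) (fun t => A k t * A k t) V.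
  exact/has_mean_int/(sq_integrableM (A2 k) (A2 k)).
have fint := has_mean_int (sq_integrable_int sq_Xf).
have gint m := has_mean_int (sq_integrable_int (sq_Zg m)).
have fAint := has_mean_int (sq_integrableM sq_Xf (sq_A cX k)).
have gAint := has_mean_int (sq_integrableM (sq_Zg k.+1) (sq_A cY k)).
have [_ J1] := has_mean_coord_mean thP (copy cX k) (has_mean_interpolated k).
have Xfree : free_of Xf (copy cY k) by move=> s w; rewrite /Xf pick_row_free.
have Zfree : free_of (Zg k.+1) (copy cX k).
  by move=> s w; rewrite /Zg pick_row_free// colXY_succ.
have J2 := has_mean_mul_coord_mean thP fint (gint k.+1) Xfree Zfree
  (has_mean_interpolated k.+1).
have AXfree : free_of (Ak cX k) (copy cY k).
  by move=> s w; rewrite /Ak mxE copy_eq.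
have AYfree : free_of (Ak cY k) (copy cX k).
  by move=> s w; rewrite /Ak mxE copy_eq.
have XAfree : free_of (fun w => Xf w * Ak cX k w) (copy cY k).
  by move=> s w; rewrite Xfree AXfree.
have ZAfree : free_of (fun w => Zg k.+1 w * Ak cY k w) (copy cX k).
  by move=> s w; rewrite Zfree AYfree.
have S1 := has_mean_mul_coord_mean thP fAint gAint XAfree ZAfree (has_mean_cross k).
apply: le_has_mean (has_meanZ V^-1 S1) (has_meanB J1 J2).
have := sq_integrable_section thP (copy cX k) (sq_Zg k).
have := sq_integrable_section thP (copy cX k) sq_Xf.
apply: filterS2 => w; rewrite /coord_mean !nu_copy /Xf /Zg.
pose phi s := f (upd k s (pick_row colX w)).
pose gam s := g (upd k s (pick_row (colXY k) w)).
have XE s : pick_row colX (upd (copy cX k) s w) = upd k s (pick_row colX w).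
  by rewrite pick_row_upd.
have ZE s : pick_row (colXY k) (upd (copy cX k) s w) =
    upd k s (pick_row (colXY k) w).
  by rewrite pick_row_upd colXY_k.
have ZE' s : pick_row (colXY k.+1) (upd (copy cY k) s w) =
    upd k s (pick_row (colXY k) w).
  by rewrite pick_row_upd colXY_succ -pick_row_XY_succ.
have -> : (fun s => f (pick_row colX (upd (copy cX k) s w))) = phi.
  by apply/funext => s; rewrite XE.
have -> : (fun s => g (pick_row (colXY k) (upd (copy cX k) s w))) = gam.
  by apply/funext => s; rewrite ZE.
move=> phi2 gam2.
have := covariance_convex_wrt (f_convex k _) (g_convex k _) (A0 k) hV
  (has_mean_int (sq_integrable_int phi2)) (has_mean_int (sq_integrable_int gam2))
  (has_mean_int (sq_integrableM phi2 gam2))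
  (has_mean_int (sq_integrableM (A2 k) phi2))
  (has_mean_int (sq_integrableM (A2 k) gam2)).
congr (_ * (_ * _) <= _ - _ * _); apply: eq_Rintegral => s _.
- by rewrite XE /Ak mxE eqxx mulrC.
- by rewrite ZE' /Ak mxE eqxx mulrC.
- by rewrite XE ZE.
- by rewrite ZE'.
Qed.

Lemma interpolated_mean0E : interpolated_mean 0 = \int[mu]_x (f x * g x).
Proof.
have H := preserving_has_mean (preserving_pick_row colX)
  (has_mean_int (sq_integrableM f2 g2)).
exact: (has_mean_uniq (has_mean_interpolated 0) H).
Qed.

Lemma interpolated_mean_dE : interpolated_mean d = (\int[mu]_x f x) * (\int[mu]_x g x).
Proof.
have fi := has_mean_int (sq_integrable_int f2).
have gi := has_mean_int (sq_integrable_int g2).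
have hX := preserving_has_mean (preserving_pick_row colX) fi.
have hY := preserving_has_mean (preserving_pick_row (colXY d)) gi.
pose P j := [exists i, j == copy cX i].
have := preserving_has_mean (preserving_mix thP P) (has_mean_interpolated d).
move=> /has_mean_fubini[_]; have := has_meanZ (\int[mu]_x g x) hX.
rewrite mulrC => h1 h2; apply: (has_mean_uniq h2).
apply: eq_has_mean h1 => // w'; rewrite mulrC -hY.2 -RintegralZl//; last exact: hY.1.
apply: eq_Rintegral => w _; congr (f _ * g _).
  apply/rowP => i; rewrite !mxE /P; case: existsP => // -[].
  by exists i.
apply/rowP => i; rewrite !mxE /P; case: existsP => // -[i'].
by rewrite copy_eq /colXY ltn_ord.
Qed.

(** The drops telescope from the mean of f g to the product of the means. *)
Lemma covariance_ge0 : (forall k, 0 <= cross_moment k) -> (0 <= covariance mu f g)%E.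
Proof.
move=> cross0; rewrite (covariance_has_mean (has_mean_int (sq_integrable_int f2))
  (has_mean_int (sq_integrable_int g2)) (has_mean_int (sq_integrableM f2 g2))).
rewrite lee_fin -interpolated_mean_dE -interpolated_mean0E subr_ge0.
suff H m : (m <= d)%N -> interpolated_mean m <= interpolated_mean 0 by exact: H.
elim: m => [//|m IH] md; apply: le_trans (IH (ltnW md)).
rewrite -subr_ge0; apply: le_trans (interpolated_mean_step (Ordinal md)).
rewrite mulr_ge0// invr_ge0; apply: Rintegral_ge0 => t _.
exact: sqr_ge0.
Qed.


Lemma Xf_log_supermodular : log_supermodular f -> log_supermodular Xf.
Proof. by move=> ff x y; rewrite /Xf pick_row_join pick_row_meet. Qed.

Lemma measurable_Ak c k : measurable_fun setT (Ak c k).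
Proof. exact: (sq_A c k).1. Qed.

Lemma increasing_Ak c k : {homo A k : s t / s <= t} -> increasing (Ak c k).
Proof. by move=> Ak_nd x y xy; apply: Ak_nd; exact: xy. Qed.

Section even_case.
Hypotheses (f_gt0 : forall x, 0 < f x) (g_gt0 : forall x, 0 < g x).
Hypotheses (ff : log_supermodular f) (gg : log_supermodular g).
Hypotheses (f_even : forall x, f (- x) = f x) (g_even : forall x, g (- x) = g x).
Hypothesis muk_sym : forall i (B : set (measurableTypeR R)), measurable B ->
  muk i ((-%R : R -> R) @^-1` B) = muk i B.
Hypothesis nu_muk : forall j, exists i, nu j = muk i.

Lemma pick_rowN col w : pick_row col (- w) = - pick_row col w.
Proof. by apply/rowP => i; rewrite !mxE. Qed.

(** The weighted mean of [Ak cX k] under the even density is the mean of an odd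
    function for a symmetric law. *)
Lemma cross_moment_ge0_even k : {homo A k : s t / s <= t} ->
  (forall t, A k (- t) = - A k t) -> 0 <= cross_moment k.
Proof.
move=> A_nd A_odd; pose F w := Xf w * Zg k.+1 w.
have F_gt0 w : 0 < F w by rewrite mulr_gt0// ?f_gt0 ?g_gt0.
have FF : log_supermodular F.
  move=> x y; rewrite /F mulrACA [leRHS]mulrACA /Xf /Zg.
  rewrite !pick_row_join !pick_row_meet ler_pM//; by rewrite mulr_ge0// ltW.
have Fa := has_mean_interpolated k.+1.
have h1 := sq_mulA (col := colX) (c := cY) (k := k) f2 isT.
have h2 := sq_mulA (col := colXY k.+1) (c := cX) (k := k) g2.
rewrite colXY_succ in h2.
have Fb : has_mean th (fun w => F w * Ak cX k w)
    (\int[th]_w (F w * Ak cX k w)).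
  apply: has_mean_int; have := sq_integrableM sq_Xf (h2 isT).
  by apply: eq_integrable => // w _ /=; congr EFin; rewrite /F/Zg; ring.
have Fc : has_mean th (fun w => F w * Ak cY k w)
    (\int[th]_w (F w * Ak cY k w)).
  apply: has_mean_int; have := sq_integrableM h1 (sq_Zg k.+1).
  by apply: eq_integrable => // w _ /=; congr EFin; rewrite /F/Xf; ring.
have Fe : has_mean th (fun w => F w * (Ak cX k w * Ak cY k w)) (cross_moment k).
  by apply: eq_has_mean (has_mean_cross k) => // w; rewrite /F mulrACA.
have := fkg thP (fun w => ltW (F_gt0 w)) FF (measurable_Ak cX k)
  (measurable_Ak cY k) (increasing_Ak cX A_nd) (increasing_Ak cY A_nd) Fa Fb Fc Fe.
have symm : preserving th th -%R.
  apply: (preserving_opp thP) => j B mB; have [i ->] := nu_muk j.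
  exact: muk_sym.
have b0 : \int[th]_w (F w * Ak cX k w) = 0.
  have h := preserving_has_mean symm Fb.
  have h' : has_mean th (fun w => F (- w) * Ak cX k (- w))
      (- 1 * \int[th]_w (F w * Ak cX k w)).
    apply: eq_has_mean (has_meanZ (- 1) Fb) => // w.
    rewrite /F /Xf /Zg !pick_rowN f_even g_even /Ak mxE A_odd.
    by ring.
  by have := has_mean_uniq h h'; lra.
by rewrite b0 mul0r pmulr_rge0//; exact: has_mean_gt0 Fa.
Qed.

End even_case.

Section orthogonal_case.
Hypotheses (f_gt0 : forall x, 0 < f x) (ff : log_supermodular f).
Hypothesis gg : supermodular g.

Definition Zg' k w := g (pick_row (colXYT k) w).

Lemma colXYT_k k : colXYT k k = cT.
Proof. by rewrite /colXYT ltnn eqxx. Qed.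

Definition swapYT k : {perm 'I_n} := tperm (copy cY k) (copy cT k).

(** Exchanging Y_k and T_k turns Z_(k+1) into the vector used in [Zg'], so that
    [Zg'] produces the same cross moment as [Zg]. *)
Lemma preserving_swapYT k : preserving th th (reindex_row (swapYT k)).
Proof.
apply: (preserving_reindex (@perm_inj _ (swapYT k)) thP).
have -> // : nu \o swapYT k = nu.
by apply/funext => j /=; case: tpermP => // ->; rewrite !nu_copy.
Qed.

Lemma Xf_swapYT k w : Xf (reindex_row (swapYT k) w) = Xf w.
Proof.
rewrite /Xf; congr f; apply/rowP => i; rewrite !mxE tpermD// copy_eq//.
Qed.

Lemma Zg_swapYT k w : Zg k.+1 (reindex_row (swapYT k) w) = Zg' k w.
Proof.
rewrite /Zg /Zg'; congr g; apply/rowP => i; rewrite !mxE /colXY /colXYT ltnS.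
rewrite [(i <= k)%N]leq_eqVlt; have [<-|ik] := eqVneq i k.
  by rewrite eqxx ltnn tpermL.
rewrite (negbTE (ik : val i != val k))/=.
by case: ifP => _; rewrite tpermD// copy_eq// eq_sym negb_and ik.
Qed.

(** Since [A k] is centered and Y_k, T_k are independent, twice the cross moment
    is the mean of f(X) A_k(X_k) (g(Z) - g(Z')) (A_k(Y_k) - A_k(T_k)), where Z'
    is Z_(k+1) with T_k in place of Y_k.  For fixed Y and T_k, the last two
    factors form an increasing function of X: by supermodularity the increment
    of g between the levels T_k and Y_k grows with the other coordinates, and
    A_k(Y_k) - A_k(T_k) is a constant of the sign of Y_k - T_k.  The inequality
    [fkg] in X with density f(X) concludes, as A_k(X_k) has weighted mean 0. *)
Lemma cross_moment_ge0_orthogonal k : {homo A k : s t / s <= t} ->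
  has_mean mu (fun x => f x * A k (x ord0 k)) 0 -> 0 <= cross_moment k.
Proof.
move=> A_nd fA0.
have sqZg' : sq_integrable th (Zg' k) by exact: sq_pick.
have fX c : c != cX -> sq_integrable th (fun w => Xf w * Ak c k w).
  by move=> cX'; apply: sq_mulA; rewrite // eq_sym.
have gX : sq_integrable th (fun w => Zg k.+1 w * Ak cX k w).
  by apply: sq_mulA => //; rewrite colXY_succ.
have gX' : sq_integrable th (fun w => Zg' k w * Ak cX k w).
  by apply: sq_mulA => //; rewrite colXYT_k.
have t1 := has_mean_cross k.
have t4 : has_mean th
    (fun w => (Xf w * Ak cX k w) * (Zg' k w * Ak cT k w)) (cross_moment k).
  apply: eq_has_mean (preserving_has_mean (preserving_swapYT k) t1) => // w.
  rewrite Xf_swapYT Zg_swapYT /Ak !mxE tpermL tpermD// ?copy_eq//.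
have free_A c c' : c != c' -> free_of (Ak c k) (copy c' k).
  by move=> /negbTE cc s w; rewrite /Ak mxE copy_eq cc.
have XAfree c : c != cX -> free_of (fun w => Xf w * Ak cX k w) (copy c k).
  move=> cX' s w; rewrite free_A 1?eq_sym// /Xf pick_row_free//.
  by rewrite eq_sym.
have mXA : measurable_fun setT (fun w => Xf w * Ak cX k w).
  by apply: measurable_funM; [exact: sq_Xf.1|exact: measurable_Ak].
have A0' c : has_mean (nu (copy c k)) (A k) 0 by rewrite nu_copy.
have t2 : has_mean th (fun w => (Xf w * Ak cX k w) * (Zg k.+1 w * Ak cT k w)) 0.
  have h := has_mean_int (sq_integrableM (fX cT isT) gX).
  have E : (fun w => Xf w * Ak cT k w * (Zg k.+1 w * Ak cX k w)) =1
      (fun w => A k (w ord0 (copy cT k)) * (Xf w * Ak cX k w * Zg k.+1 w)).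
    by move=> w; rewrite /Ak; ring.
  have m0 := mean0_mul_free thP (A0' cT) _ _ (eq_has_mean E erefl h).
  apply: eq_has_mean h => [w|]; first by ring.
  apply: m0; first exact: measurable_funM mXA (sq_Zg k.+1).1.
  by move=> s w; rewrite XAfree// /Zg pick_row_free// colXY_succ.
have t3 : has_mean th (fun w => (Xf w * Ak cX k w) * (Zg' k w * Ak cY k w)) 0.
  have h := has_mean_int (sq_integrableM (fX cY isT) gX').
  have E : (fun w => Xf w * Ak cY k w * (Zg' k w * Ak cX k w)) =1
      (fun w => A k (w ord0 (copy cY k)) * (Xf w * Ak cX k w * Zg' k w)).
    by move=> w; rewrite /Ak; ring.
  have m0 := mean0_mul_free thP (A0' cY) _ _ (eq_has_mean E erefl h).
  apply: eq_has_mean h => [w|]; first by ring.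
  apply: m0; first exact: measurable_funM mXA sqZg'.1.
  by move=> s w; rewrite XAfree// /Zg' pick_row_free// colXYT_k.
pose q0 w := (Zg k.+1 w - Zg' k w) * (Ak cY k w - Ak cT k w).
have r_mean : has_mean th (fun w => (Xf w * Ak cX k w) * q0 w) (2 * cross_moment k).
  apply: eq_has_mean (has_meanD (has_meanB t1 t2) (has_meanB t4 t3)).
    by move=> w; rewrite /q0; ring.
  by ring.
have q_mean : has_mean th (fun w => Xf w * q0 w) (\int[th]_w (Xf w * q0 w)).
  apply: has_mean_int.
  have h1 := has_mean_int (sq_integrableM (fX cY isT) (sq_Zg k.+1)).
  have h2 := has_mean_int (sq_integrableM (fX cT isT) (sq_Zg k.+1)).
  have h3 := has_mean_int (sq_integrableM (fX cY isT) sqZg').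
  have h4 := has_mean_int (sq_integrableM (fX cT isT) sqZg').
  apply: (eq_has_mean _ erefl
    (has_meanD (has_meanB h1 h2) (has_meanB h4 h3))).1 => w.
  by rewrite /q0; ring.
(* [P] selects the coordinates of Y and T, which are fixed by the outer
   integration; the inner one is over X. *)
pose P j := ~~ [exists i, j == copy cX i].
have PX i : P (copy cX i) = false by apply/negbTE/negPn/existsP; exists i.
have Pc c i : c != cX -> P (copy c i) = true.
  by move=> /negbTE cc; apply/negP => /existsP[i']; rewrite copy_eq cc.
have [r_int r_mean'] :=
  has_mean_fubini (preserving_has_mean (preserving_mix thP P) r_mean).
have [q_int _] :=
  has_mean_fubini (preserving_has_mean (preserving_mix thP P) q_mean).
suff : 0 <= 2 * cross_moment k by rewrite pmulr_rge0.
apply: has_mean_ge0 r_mean'.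
apply: filterS2 r_int q_int => w /= ri qi.
have XE w' : Xf (mix P w w') = Xf w'.
  by rewrite /Xf; congr f; apply/rowP => i; rewrite !mxE PX.
have AXE w' : Ak cX k (mix P w w') = Ak cX k w' by rewrite /Ak mxE PX.
have AE c w' : c != cX -> Ak c k (mix P w w') = Ak c k w.
  by move=> cc; rewrite /Ak mxE Pc.
pose q w' := q0 (mix P w w').
have mmix : measurable_fun setT (mix P w).
  have mpair : measurable_fun setT (fun w' : 'rV[R]_n => (w, w')).
    exact: measurable_fun_pair.
  exact: (measurableT_comp (measurable_mix P) mpair).
have mq : measurable_fun setT q.
  apply: measurableT_comp => //; apply: measurable_funM; apply: measurable_funB.
  - exact: (sq_Zg k.+1).1.
  - exact: sqZg'.1.
  - exact: measurable_Ak.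
  - exact: measurable_Ak.
have iq : increasing q.
  move=> x y xy; rewrite /q /q0 !AE// /Zg /Zg'.
  set a1 := pick_row _ (mix P w x); set b1 := pick_row _ (mix P w x).
  set a2 := pick_row _ (mix P w y); set b2 := pick_row _ (mix P w y).
  pose Yk := w ord0 (copy cY k); pose Tk := w ord0 (copy cT k).
  (* Coordinate [i] of the four vectors comes from Y_k or T_k, from a fixed
     value of Y, or from X, in this order. *)
  have entries i : [\/ [/\ a1 ord0 i = Yk, a2 ord0 i = Yk, b1 ord0 i = Tk
        & b2 ord0 i = Tk],
      exists s, [/\ a1 ord0 i = s, a2 ord0 i = s, b1 ord0 i = s & b2 ord0 i = s]
    | exists s t, [/\ a1 ord0 i = s, a2 ord0 i = t, b1 ord0 i = s, b2 ord0 i = t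
        & s <= t]].
    rewrite !mxE /colXY /colXYT ltnS leq_eqVlt.
    have [->|ik] := eqVneq i k.
      by rewrite eqxx ltnn /= !Pc//; apply: Or31; split.
    rewrite (negbTE (ik : val i != val k))/=; case: (i < k)%N.
      by rewrite !Pc//; apply: Or32; eexists; split.
    by rewrite !PX; apply: Or33; do 2 eexists; split => //; exact: xy.
  have [TY|/ltW YT] := leP Tk Yk.
    have jE : joinv a1 b2 = a2.
      apply/rowP => i; rewrite mxE.
      case: (entries i) => [[-> -> _ ->]|[s [-> -> _ ->]]|[s [t [-> -> _ -> st]]]].
      - exact: max_l.
      - exact: maxxx.
      - exact: max_r.
    have mE : meetv a1 b2 = b1.
      apply/rowP => i; rewrite mxE.
      case: (entries i) => [[-> _ -> ->]|[s [-> _ -> ->]]|[s [t [-> _ -> -> st]]]].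
      - exact: min_r.
      - exact: minxx.
      - exact: min_l.
    apply: ler_wpM2r; first by rewrite subr_ge0; exact: A_nd.
    by have := gg a1 b2; rewrite jE mE; lra.
  have jE : joinv b1 a2 = b2.
    apply/rowP => i; rewrite mxE.
    case: (entries i) => [[_ -> -> ->]|[s [_ -> -> ->]]|[s [t [_ -> -> -> st]]]].
    - exact: max_l.
    - exact: maxxx.
    - exact: max_r.
  have mE : meetv b1 a2 = a1.
    apply/rowP => i; rewrite mxE.
    case: (entries i) => [[-> -> -> _]|[s [-> -> -> _]]|[s [t [-> -> -> _ st]]]].
    - exact: min_r.
    - exact: minxx.
    - exact: min_l.
  apply: ler_wnM2r; first by rewrite subr_le0; exact: A_nd.
  by have := gg b1 a2; rewrite jE mE; lra.
have Fa := has_mean_int (sq_integrable_int sq_Xf).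
have Fb := preserving_has_mean (preserving_pick_row colX) fA0.
have Fb' : has_mean th (fun w => Xf w * Ak cX k w) 0.
  by apply: eq_has_mean Fb => // w'; rewrite /Xf mxE.
have Fc : has_mean th (fun w' => Xf w' * q w') (\int[th]_w' (Xf w' * q w')).
  apply: has_mean_int; apply: eq_integrable qi => // w' _ /=.
  by rewrite XE.
have Fe : has_mean th (fun w' => Xf w' * (Ak cX k w' * q w'))
    (\int[th]_w' (Xf (mix P w w') * Ak cX k (mix P w w') * q0 (mix P w w'))).
  apply: eq_has_mean (has_mean_int ri) => // w'.
  by rewrite XE AXE mulrA.
have := fkg thP (fun w => ltW (f_gt0 _)) (Xf_log_supermodular ff)
  (measurable_Ak cX k) mq (increasing_Ak cX A_nd) iq Fa Fb' Fc Fe.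
by rewrite mul0r pmulr_rge0// (has_mean_gt0 (fun w => f_gt0 _) Fa).
Qed.

End orthogonal_case.

End copies.
(** * The theorem *)

Section hypotheses.
Context (R : realType).

Lemma primitive_nondecreasing (a A : R -> R) :
  (forall t, 0 < a t) -> (forall t, is_derive t (1 : R) A (a t)) ->
  {homo A : s t / s <= t}.
Proof.
move=> a0 Aa s t st.
exact: (is_derive_ge0_le Aa (fun u _ _ => ltW (a0 u)) st).
Qed.

(** The even part of [A] has zero derivative, so it is a constant, and its mean
    is zero. *)
Lemma centered_primitive_odd (P : probability (measurableTypeR R) R)
    (a A : R -> R) :
  (forall t, is_derive t (1 : R) A (a t)) ->
  (forall t, a (- t) = a t) -> has_mean P A 0 ->
  preserving P P (-%R : measurableTypeR R -> measurableTypeR R) ->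
  forall t, A (- t) = - A t.
Proof.
move=> Aa a_even A0 symP t; pose D := (A \o -%R) + A.
have Dd s : is_derive s (1 : R) D 0.
  have -> : (0 : R) = a (- s) * (- 1) + a s by rewrite a_even; ring.
  exact: is_deriveD.
have Dcst s : D s = D 0 by exact: (is_derive_0_is_cst s 0 Dd).
have hD : has_mean P D 0.
  apply: eq_has_mean (has_meanD (preserving_has_mean symP A0) A0) => //.
  by rewrite addr0.
have D0 := has_mean_uniq (has_mean_cst P (D 0)) 
  (eq_has_mean (T := measurableTypeR R) Dcst erefl hD).
by apply/eqP; rewrite -addr_eq0; apply/eqP; rewrite -[LHS]/(D t) Dcst.
Qed.

Variables (d : nat) (muk : 'I_d -> probability (measurableTypeR R) R).
Variable mu : probability 'rV[R]_d R.
Hypothesis muP : is_product_measure muk mu.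

Lemma marginal_symmetric : symmetric_measure mu ->
  forall i (B : set (measurableTypeR R)), measurable B ->
  muk i ((-%R : R -> R) @^-1` B) = muk i B.
Proof.
move=> mu_sym i B mB; have [mc cE] := preserving_coord muP i.
have mNB : measurable ((-%R : R -> R) @^-1` B : set (measurableTypeR R)).
  rewrite -[X in measurable X]setTI.
  exact: (@oppr_measurable R setT measurableT _ mB).
have mcB : measurable ((fun w : 'rV[R]_d => w ord0 i) @^-1` B).
  by rewrite -[X in measurable X]setTI; exact: mc.
rewrite -(cE _ mB) -(cE _ mNB); apply: etrans (mu_sym _ mcB).
by congr (mu _); apply/seteqP; split=> x /=; rewrite mxE.
Qed.

End hypotheses.

Theorem theorem1p10 (R : realType) (d : nat)
    (muk : 'I_d -> probability (measurableTypeR R) R)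
    (mu : probability 'rV[R]_d R)
    (a A : 'I_d -> R -> R) (f g : 'rV[R]_d -> R)
    (mu_product : is_product_measure muk mu)
    (a_gt0 : forall k t, 0 < a k t)
    (A_primitive : forall k (t : R), is_derive t (1 : R) (A k) (a k t))
    (A_L2 : forall k,
      (A k : measurableTypeR R -> R) \in Lfun (muk k) 2%:E)
    (A_centered : forall k, (\int[muk k]_t (A k t)%:E = 0)%E)
    (f_L2 : f \in Lfun mu 2%:E) (g_L2 : g \in Lfun mu 2%:E)
    (f_partials : integrable_pderivs2 mu f)
    (g_partials : integrable_pderivs2 mu g) :
  (forall phi : 'rV[R]_d -> R,
    (forall x, f x = expR (- phi x)) ->
    (forall i x, derivable (weighted_pderiv a i phi) x (unit_vec R i)) ->
    (forall i x, derivable (weighted_pderiv a i g) x (unit_vec R i)) ->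
    (forall x i, pderiv i (weighted_pderiv a i phi) x <= 0 /\
                 0 <= pderiv i (weighted_pderiv a i g) x) ->
    (forall x i j, i != j -> pderiv i (pderiv j phi) x <= 0 /\
                             0 <= pderiv i (pderiv j g) x) ->
    (forall i, covariance mu f (fun x => A i (x ord0 i)) = 0%E) ->
    (0 <= covariance mu f g)%E)
  /\
  (forall phi psi : 'rV[R]_d -> R,
    (forall x, f x = expR (- phi x)) ->
    (forall x, g x = expR (- psi x)) ->
    (forall i x, derivable (weighted_pderiv a i phi) x (unit_vec R i)) ->
    (forall i x, derivable (weighted_pderiv a i psi) x (unit_vec R i)) ->
    (forall x i, pderiv i (weighted_pderiv a i phi) x <= 0 /\
                 pderiv i (weighted_pderiv a i psi) x <= 0) ->
    (forall x i j, i != j -> pderiv i (pderiv j phi) x <= 0 /\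
                             pderiv i (pderiv j psi) x <= 0) ->
    symmetric_measure mu ->
    (forall i, even_fun (a i)) ->
    even_fun f ->
    even_fun g ->
    (0 <= covariance mu f g)%E).
Proof.
have a_prim k t : is_derive t (1 : R) (A k) (a k t) by exact: A_primitive.
have A2 k : sq_integrable (muk k) (A k) by exact: Lfun_sq_integrable.
have A0 k : has_mean (muk k) (A k) 0.
  have := has_mean_int (sq_integrable_int (A2 k)).
  by rewrite /Rintegral A_centered.
have f2 := Lfun_sq_integrable f_L2; have g2 := Lfun_sq_integrable g_L2.
have A_nd k := primitive_nondecreasing (a_gt0 k) (a_prim k).
have f1 i : has_pderiv i f by case: f_partials => h _ x; case: (h i).
have g1 i : has_pderiv i g by case: g_partials => h _ x; case: (h i).
have f11 i j : has_pderiv i (pderiv j f).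
  by case: f_partials => _ h x; case: (h j i).
have g11 i j : has_pderiv i (pderiv j g).
  by case: g_partials => _ h x; case: (h j i).
pose copy (c : option bool) (i : 'I_d) : 'I_#|{: option bool * 'I_d}| :=
  enum_rank (c, i).
have copy_inj c c' i i' : copy c i = copy c' i' -> c = c' /\ i = i'.
  by move=> /enum_rank_inj[].
pose nu (j : 'I_#|{: option bool * 'I_d}|) := muk (enum_val j).2.
have nu_copy c i : nu (copy c i) = muk i by rewrite /nu enum_rankK.
have nu_muk j : exists i, nu j = muk i by exists (enum_val j).2.
have [th thP] := product_measure_exists nu.
have cov_ge0 := covariance_ge0 mu_product copy_inj thP nu_copy A2 A0 f2 g2.
split.
  move=> phi fE phi_i g_i phi_g_i phi_g_ij fA0.
  have f_gt0 x : 0 < f x by rewrite fE expR_gt0.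
  have ff : log_supermodular f.
    apply: (exponent_log_supermodular fE f1 f11) => x i j ij.
    by case: (phi_g_ij x i j ij).
  have gg : supermodular g.
    apply: (supermodular_of_pderiv2 g1) => [i j _|i j x ij]; first exact: g11.
    by case: (phi_g_ij x i j ij).
  apply: cov_ge0 => [k x|k x|k].
  - apply: (exponent_convex_wrt fE (a_gt0 k) (a_prim k) (f1 k) (phi_i k)).
    by move=> y; case: (phi_g_i y k).
  - apply: (convex_wrt_of_weighted_pderiv (a_gt0 k) (a_prim k) (g1 k) (g_i k)).
    by move=> y; case: (phi_g_i y k).
  have Ax2 : sq_integrable mu (fun x => A k (x ord0 k)).
    exact: (preserving_sq_integrable (preserving_coord mu_product k) (A2 k)).
  have fA := has_mean_int (sq_integrableM f2 Ax2).
  apply: (cross_moment_ge0_orthogonal mu_product copy_inj thP nu_copy A2 A0 f2 g2 f_gt0 ff gg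
    (A_nd k)).
  have := fA0 k; rewrite (covariance_has_mean
    (has_mean_int (sq_integrable_int f2))
    (preserving_has_mean (preserving_coord mu_product k) (A0 k)) fA).
  by rewrite mulr0 subr0 => -[fA_eq0]; rewrite fA_eq0 in fA.
move=> phi psi fE gE phi_i psi_i phi_psi_i phi_psi_ij mu_sym a_even f_even g_even.
have f_gt0 x : 0 < f x by rewrite fE expR_gt0.
have g_gt0 x : 0 < g x by rewrite gE expR_gt0.
have ff : log_supermodular f.
  apply: (exponent_log_supermodular fE f1 f11) => x i j ij.
  by case: (phi_psi_ij x i j ij).
have gg : log_supermodular g.
  apply: (exponent_log_supermodular gE g1 g11) => x i j ij.
  by case: (phi_psi_ij x i j ij).
have muk_sym := marginal_symmetric mu_product mu_sym.
have symP k : preserving (muk k) (muk k)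
    (-%R : measurableTypeR R -> measurableTypeR R).
  by split; [exact: oppr_measurable|exact: muk_sym].
apply: cov_ge0 => [k x|k x|k].
- apply: (exponent_convex_wrt fE (a_gt0 k) (a_prim k) (f1 k) (phi_i k)).
  by move=> y; case: (phi_psi_i y k).
- apply: (exponent_convex_wrt gE (a_gt0 k) (a_prim k) (g1 k) (psi_i k)).
  by move=> y; case: (phi_psi_i y k).
apply: (cross_moment_ge0_even mu_product copy_inj thP nu_copy A2 f2 g2 f_gt0 g_gt0 ff gg
  f_even g_even muk_sym nu_muk (A_nd k)).
exact: (centered_primitive_odd (a_prim k) (a_even k) (A0 k) (symP k)).
Qed.
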